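(* Suppose the MDP is uniformly ergodic (as defined in the context), so that $t_{\mathrm{minorize}}<\infty$, and that $t_{\mathrm{minorize}}$ is known. Fix an error tolerance $\epsilon\in(0,1]$ and a failure probability $\delta\in(0,1)$. Run the algorithm PMBP$(\gamma,\zeta,n)$ with \[ \gamma = 1-\frac{\epsilon}{19\,t_{\mathrm{minorize}}},\qquad \zeta=\frac14(1-\gamma)t_{\mathrm{minorize}},\qquad n=\frac{c\,\beta_\delta(\eta^*_\delta)}{(1-\gamma)^2 t_{\mathrm{minorize}}},\quad c=4\cdot 486^2, \] and let $\hat\pi_0$ be its output. Then with probability at least $1-\delta$, \[ 0\le \bar\alpha-\alpha^{\hat\pi_0}\le \epsilon , \] and the total number of samples used, $|S||A|n$, is $\widetilde O\big(|S||A|\,t_{\mathrm{minorize}}\,\epsilon^{-2}\big)$ (where $\widetilde O$ hides factors logarithmic in $|S|,|A|,t_{\mathrm{minorize}},\epsilon^{-1},\delta^{-1}$).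
   Context: $S,A$ are finite state and action sets. An MDP is given by a reward $r:S\times A\to[0,1]$ and a transition kernel $P=\{p_{s,a}\in\mathcal P(S)\}$; for a probability vector $p$ and $v\in\mathbb R^{S}$, $p[v]=\sum_s p(s)v(s)$. $\Pi$ is the (finite) set of deterministic stationary Markov policies $\pi:S\to A$; $P_\pi(s,s')=p_{s,\pi(s)}(s')$, $r_\pi(s)=r(s,\pi(s))$. Uniform ergodicity: for every $\pi\in\Pi$ there exist an integer $m\ge1$, $q\in(0,1]$ and $\psi\in\mathcal P(S)$ with $P_\pi^m(s,\cdot)\ge q\psi(\cdot)$ for all $s\in S$. For such $\pi$, $t_{\mathrm{minorize}}(P_\pi)=\inf\{m/q:\ P_\pi^m(s,\cdot)\ge q\psi(\cdot)\ \forall s \text{ for some }\psi\in\mathcal P(S)\}$, and $t_{\mathrm{minorize}}=\max_{\pi\in\Pi}t_{\mathrm{minorize}}(P_\pi)$. The long-run average reward of $\pi$ is $\alpha^\pi=\lim_{T\to\infty}\frac1T E^\pi_\mu[\sum_{t=0}^{T-1}r(X_t,A_t)]$ (the limit exists and does not depend on the initial distribution $\mu$ under uniform ergodicity), and $\bar\alpha=\max_{\pi\in\Pi}\alpha^\pi$. Generative model: for any $(s,a)$ one can draw independent samples from $p_{s,a}$. Algorithm PMBP$(\gamma,\zeta,n)$ (perturbed model-based planning): draw $Z(s,a)\sim\mathrm{Unif}(0,\zeta)$ i.i.d. over $(s,a)\in S\times A$ and set $R=r+Z$; independently, for each $(s,a)$ draw $n$ i.i.d. samples $S^{(1)}_{s,a},\dots,S^{(n)}_{s,a}\sim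 p_{s,a}$ and form $\hat p_{s,a}(s')=\frac1n\sum_{i=1}^n\mathbf 1\{S^{(i)}_{s,a}=s'\}$; compute the unique $\hat v_0\in\mathbb R^S$ with $\hat v_0(s)=\max_{a}\{R(s,a)+\gamma\hat p_{s,a}[\hat v_0]\}$ for all $s$, and return a greedy policy $\hat\pi_0(s)\in\arg\max_a\{R(s,a)+\gamma\hat p_{s,a}[\hat v_0]\}$. Parameters: $\beta_\delta(\eta)=2\log\!\Big(\frac{24|S||A|\log_2((1-\gamma)^{-1})}{(1-\gamma)^2\eta\delta}\Big)$ and $\eta^*_\delta=\frac{\zeta\delta(1-\gamma)}{9|S||A|^2}$. *)

(* Defs.v *)
From HB Require Import structures.
From mathcomp Require Import all_boot all_order all_algebra.
From mathcomp Require Import all_classical all_reals all_analysis.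
Set Implicit Arguments. Unset Strict Implicit. Unset Printing Implicit Defensive.
Import Order.TTheory GRing.Theory Num.Theory.
Import numFieldNormedType.Exports.
Local Open Scope ring_scope.
Local Open Scope classical_set_scope.

Section MDP.
Variables (R : realType) (S A : finType).

Definition is_prob (mu : S -> R) : Prop :=
  (forall s, 0 <= mu s) /\ \sum_(s : S) mu s = 1.

Definition dirac_vec (s0 : S) : S -> R := fun s => (s == s0)%:R.

Definition policy := {ffun S -> A}.

Fixpoint distn (p : S -> A -> S -> R) (pi : policy) (mu : S -> R) (t : nat)
  : S -> R :=
  match t with
  | 0 => mu
  | t'.+1 => fun s' => \sum_(s : S) distn p pi mu t' s * p s (pi s) s'
  end.

Definition exp_reward (r : S -> A -> R) (p : S -> A -> S -> R) (pi : policy)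
  (mu : S -> R) (t : nat) : R :=
  \sum_(s : S) distn p pi mu t s * r s (pi s).

Definition avg_reward (r : S -> A -> R) (p : S -> A -> S -> R) (mu : S -> R)
  (pi : policy) : R :=
  limn (fun T : nat =>
          ((T.+1%:R)^-1 * \sum_(t < T.+1) exp_reward r p pi mu t : R)).

(* alpha-bar = max over pi of alpha^pi (rewards in [0,1] so alpha^pi >= 0
   and 0 is a harmless neutral element for the max) *)
Definition opt_avg_reward (r : S -> A -> R) (p : S -> A -> S -> R)
  (mu : S -> R) : R :=
  \big[Num.max/0]_(pi : policy) avg_reward r p mu pi.

Definition minorizes (p : S -> A -> S -> R) (pi : policy) (m : nat) (q : R)
  (psi : S -> R) : Prop :=
  (0 < m)%N /\ 0 < q <= 1 /\ is_prob psi /\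
  forall s s', q * psi s' <= distn p pi (dirac_vec s) m s'.

Definition uniformly_ergodic (p : S -> A -> S -> R) : Prop :=
  forall pi : policy, exists m q psi, minorizes p pi m q psi.

Definition tminorize_pi (p : S -> A -> S -> R) (pi : policy) : R :=
  inf [set x : R | exists m q psi, minorizes p pi m q psi /\ x = m%:R / q].

Definition tminorize (p : S -> A -> S -> R) : R :=
  \big[Num.max/0]_(pi : policy) tminorize_pi p pi.

Definition phat (n : nat) (X : S -> A -> nat -> S) (s : S) (a : A) (s' : S)
  : R :=
  (n%:R)^-1 * \sum_(i < n) (X s a i == s')%:R.

Definition Qhat (Rw : S -> A -> R) (gamma : R) (ph : S -> A -> S -> R)
  (v : S -> R) (s : S) (a : A) : R :=
  Rw s a + gamma * \sum_(s' : S) ph s a s' * v s'.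

Definition bellman_fixpoint (Rw : S -> A -> R) (gamma : R)
  (ph : S -> A -> S -> R) (v : S -> R) : Prop :=
  forall s, (forall a, Qhat Rw gamma ph v s a <= v s) /\
            (exists a, Qhat Rw gamma ph v s a = v s).

(* pi is a possible output of PMBP: greedy w.r.t. the (unique) fixed point *)
Definition pmbp_output (Rw : S -> A -> R) (gamma : R) (ph : S -> A -> S -> R)
  (pi : policy) : Prop :=
  exists v, bellman_fixpoint Rw gamma ph v /\
            forall s a, Qhat Rw gamma ph v s a <= Qhat Rw gamma ph v s (pi s).

End MDP.

Section Params.
Variables (R : realType).

Definition log2 (x : R) : R := ln x / ln 2.

Definition gamma_of (eps t : R) : R := 1 - eps / (19 * t).
Definition zeta_of (gamma t : R) : R := (1 - gamma) * t / 4.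

Definition beta_of (nS nA : nat) (gamma delta eta : R) : R :=
  2 * ln (24 * nS%:R * nA%:R * log2 ((1 - gamma)^-1)
           / ((1 - gamma) ^+ 2 * eta * delta)).

Definition eta_star (nS nA : nat) (zeta delta gamma : R) : R :=
  zeta * delta * (1 - gamma) / (9 * nS%:R * nA%:R ^+ 2).

Definition c_const : R := 4 * 486 ^+ 2.

Definition n_of (nS nA : nat) (eps delta t : R) : nat :=
  let gamma := gamma_of eps t in
  let zeta := zeta_of gamma t in
  `|Num.ceil (c_const * beta_of nS nA gamma delta (eta_star nS nA zeta delta gamma)
              / ((1 - gamma) ^+ 2 * t))|%N.

Definition overlap (zeta lo hi : R) : R :=
  Num.max 0 (Num.min hi zeta - Num.max lo 0).

End Params.

(* Main.v *)
(** Let [v] be the fixed point of the empirical Bellman operator with perturbed rewards, and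
    [e(s, a)] the deviation [|phat v - p v|] at [(s, a)].

    Concentration.  Freezing the value of [s] at a number [u] turns value iteration into a
    function [V] that does not depend on the samples at [s]; when [u] is close to [v s], [V] is
    close to [v].  A linearised Bernstein bound [e <= l * var_p(v) + b], with [l] of order
    [1 - gamma], therefore follows from a union bound over a net of values of [u] and, as the
    noise is independent of the samples, from conditioning on the cell of a fine grid that
    contains the noise.

    Analysis.  With [phi = (max v - v)^2], the Bellman inequality bounds [gamma^2 var_p(v)] by
    [gamma P phi - phi + O(span v)], so that [e <= a (gamma P phi - phi) + b'] pointwise.  Hence
    [v + a phi] and [v - a phi] are a sub- and a supersolution of the Bellman equation of the
    output policy with constant errors, and minorization gives [span v = O(t)].  Integrating
    the same bound against stationary distributions, where [gamma P phi - phi] has nonpositive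
    mean, gives [abar - alpha <= (1 - gamma) span v + 2 b' + zeta = O((1 - gamma) t)].  The
    constant in [n] is large enough for no separation of the perturbed action values to be
    needed. *)
Require Import Defs.
From HB Require Import structures.
From mathcomp Require Import all_boot all_order all_algebra.
From mathcomp Require Import all_classical all_reals all_analysis.
From mathcomp Require Import ring lra.
Set Implicit Arguments. Unset Strict Implicit. Unset Printing Implicit Defensive.
Import Order.TTheory GRing.Theory Num.Theory.
Import numFieldNormedType.Exports.
Local Open Scope ring_scope.
Local Open Scope classical_set_scope.

(** * Markov chains with a minorization *)

Section Expectation.
Variables (R : realType) (S : finType).
Implicit Types (mu f g : S -> R) (c : R).

Definition ev mu f : R := \sum_(s : S) mu s * f s.

Lemma evD mu f g : ev mu (fun s => f s + g s) = ev mu f + ev mu g.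
Proof. by rewrite /ev -big_split; apply: eq_bigr => s _; rewrite mulrDr. Qed.

Lemma evZ mu c f : ev mu (fun s => c * f s) = c * ev mu f.
Proof. by rewrite /ev mulr_sumr; apply: eq_bigr => s _; rewrite mulrCA. Qed.

Lemma evN mu f : ev mu (fun s => - f s) = - ev mu f.
Proof. by rewrite /ev -sumrN; apply: eq_bigr => s _; rewrite mulrN. Qed.

Lemma evB mu f g : ev mu (fun s => f s - g s) = ev mu f - ev mu g.
Proof. by rewrite evD evN. Qed.

Lemma eq_ev mu f g : f =1 g -> ev mu f = ev mu g.
Proof. by move=> fg; apply: eq_bigr => s _; rewrite fg. Qed.

Lemma ev_cst mu c : is_prob mu -> ev mu (fun=> c) = c.
Proof. by case=> _ mu1; rewrite /ev -mulr_suml mu1 mul1r. Qed.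

Lemma le_ev mu f g : is_prob mu -> (forall s, f s <= g s) -> ev mu f <= ev mu g.
Proof. by case=> mu0 _ fg; apply: ler_sum => s _; apply: ler_wpM2l. Qed.

Lemma ev_le mu f c : is_prob mu -> (forall s, f s <= c) -> ev mu f <= c.
Proof. by move=> muP fc; rewrite -(ev_cst c muP) le_ev. Qed.

Lemma ev_ge mu f c : is_prob mu -> (forall s, c <= f s) -> c <= ev mu f.
Proof. by move=> muP fc; rewrite -(ev_cst c muP) le_ev. Qed.

Lemma ev_dirac (s : S) f : ev (dirac_vec R s) f = f s.
Proof.
rewrite /ev (bigD1 s)//= /dirac_vec eqxx mul1r big1 ?addr0// => s' /negPf ->.
by rewrite mul0r.
Qed.

Lemma dirac_is_prob (s : S) : is_prob (dirac_vec R s).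
Proof.
split=> [s'|]; first by rewrite /dirac_vec ler0n.
by rewrite -(ev_dirac s (fun=> 1)); apply: eq_bigr => s' _; rewrite mulr1.
Qed.

Lemma finfun_max (s0 : S) f : exists s1, forall s, f s <= f s1.
Proof.
by case: (@Order.TotalTheory.arg_maxP _ _ _ s0 predT f isT) => s1 _ h; exists s1 => s; apply: h.
Qed.

Lemma finfun_min (s0 : S) f : exists s1, forall s, f s1 <= f s.
Proof.
by case: (finfun_max s0 (fun s => - f s)) => s1 h; exists s1 => s; rewrite -lerN2.
Qed.

(** [s0] witnesses that [S] is nonempty. The value is taken at a chosen maximiser, so unfolding
    exposes an attaining state. *)
Definition fmax (s0 : S) f := f (sval (cid (finfun_max s0 f))).
Definition fmin (s0 : S) f := f (sval (cid (finfun_min s0 f))).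

Lemma fmax_ge s0 f s : f s <= fmax s0 f.
Proof. exact: (svalP (cid (finfun_max s0 f))). Qed.

Lemma fmin_le s0 f s : fmin s0 f <= f s.
Proof. exact: (svalP (cid (finfun_min s0 f))). Qed.

End Expectation.

(** * Iterates of a policy kernel under a minorization *)

Section Chain.
Variables (R : realType) (S A : finType) (p : S -> A -> S -> R) (pi : policy S A).
Hypothesis pP : forall s a, is_prob (p s a).
Implicit Types (mu f g : S -> R) (c : R).

Definition Pop f : S -> R := fun s => ev (p s (pi s)) f.

Lemma distn_is_prob mu t : is_prob mu -> is_prob (distn p pi mu t).
Proof.
move=> muP; elim: t => [//|t [d0 d1]] /=; split=> [s'|].
  by apply: sumr_ge0 => s _; apply: mulr_ge0 => //; case: (pP s (pi s)).
rewrite exchange_big /= -[RHS]d1; apply: eq_bigr => s _.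
by rewrite -mulr_sumr; case: (pP s (pi s)) => _ ->; rewrite mulr1.
Qed.

Lemma ev_distnS mu t f : ev (distn p pi mu t.+1) f = ev (distn p pi mu t) (Pop f).
Proof.
rewrite /ev /Pop /=.
under eq_bigr do rewrite mulr_suml.
rewrite exchange_big; apply: eq_bigr => s _ /=.
by rewrite /ev mulr_sumr; apply: eq_bigr => s' _; rewrite mulrA.
Qed.

Lemma ev_distn_iter mu t f : ev (distn p pi mu t) f = ev mu (iter t Pop f).
Proof. by elim: t f => [//|t IH] f; rewrite ev_distnS IH iterSr. Qed.

Lemma iter_Pop_distn t f s : iter t Pop f s = ev (distn p pi (dirac_vec R s) t) f.
Proof. by rewrite ev_distn_iter ev_dirac. Qed.

(** The minorization makes [d - q * psi] a nonnegative measure of mass [1 - q], against which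
    [c - f >= 0] is integrated. *)
Lemma minorize_le m q psi f c s : minorizes p pi m q psi -> (forall s, f s <= c) ->
  iter m Pop f s <= q * ev psi f + (1 - q) * c.
Proof.
move=> [_ [_ [psiP min_m]]] fc; rewrite iter_Pop_distn.
set d := distn _ _ _ _.
have dP : is_prob d by apply: distn_is_prob; exact: dirac_is_prob.
have h : 0 <= \sum_s' (d s' - q * psi s') * (c - f s').
  by apply: sumr_ge0 => s' _; rewrite mulr_ge0// subr_ge0; [exact: min_m|exact: fc].
have E : \sum_s' (d s' - q * psi s') * (c - f s') =
    ev d (fun s' => c - f s') - q * ev psi (fun s' => c - f s').
  by rewrite /ev mulr_sumr -sumrB; apply: eq_bigr => s' _; ring.
rewrite E !evB !ev_cst// in h.
lra.
Qed.

Lemma minorize_ge m q psi f c s : minorizes p pi m q psi -> (forall s, c <= f s) ->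
  q * ev psi f + (1 - q) * c <= iter m Pop f s.
Proof.
move=> minm cf.
have := @minorize_le m q psi (fun s => - f s) (- c) s minm.
rewrite !iter_Pop_distn !evN => H.
have: forall s, - f s <= - c by move=> s'; rewrite lerN2.
by move/H; lra.
Qed.

Lemma Pop_le f g s : (forall s, f s <= g s) -> Pop f s <= Pop g s.
Proof. by move=> fg; apply: le_ev. Qed.

Lemma iter_Pop_le t f g s : (forall s, f s <= g s) -> iter t Pop f s <= iter t Pop g s.
Proof. by elim: t f g s => [|t IH] f g s fg //; rewrite !iterS; apply: Pop_le => s'; apply: IH. Qed.

(* [M f1 - m f2] with a sub- and a super-solution in place of [max v - min v] : the error
   terms are then constants, and the minorization acts as in the noiseless case. *)
Lemma minorize_span m q psi (g : R) f1 f2 (B b w : R) :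
  minorizes p pi m q psi -> 0 < g < 1 -> 0 <= B -> 0 <= b -> 0 <= w ->
  (forall s, f1 s <= B + b + g * Pop f1 s) ->
  (forall s, - b + g * Pop f2 s <= f2 s) ->
  (forall s, f1 s - f2 s <= w) ->
  forall s s', f1 s - f2 s' <= B * (m%:R / q) + 2 * b / (1 - g) + w.
Proof.
move=> minm /andP[g0 g1] B0 b0 w0 h1 h2 h12 s s'.
have [m0 [/andP[q0 q1] [psiP _]]] := minm.
pose G k : R := \sum_(j < k) g ^+ j.
have i1 k x : f1 x <= (B + b) * G k + g ^+ k * iter k Pop f1 x.
  elim: k => [|k IH]; first by rewrite /G big_ord0 mulr0 add0r mul1r.
  apply: (le_trans IH); rewrite /G big_ord_recr /= -/(G k).
  have H : iter k Pop f1 x <= iter k Pop (fun y => B + b + g * Pop f1 y) x by exact: iter_Pop_le.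
  rewrite [leRHS]iter_Pop_distn evD evZ ev_cst -?iter_Pop_distn -?iterSr in H; last first.
    by apply: distn_is_prob; apply: dirac_is_prob.
  have gk : 0 <= g ^+ k by rewrite exprn_ge0// ltW.
  have := ler_wpM2l gk H; rewrite exprS /=.
  move: (iter k _ _ _) (Pop _ _) (G k) (g ^+ k) => u1 u2 u3 u4; nra.
have i2 k x : - b * G k + g ^+ k * iter k Pop f2 x <= f2 x.
  elim: k => [|k IH]; first by rewrite /G big_ord0 mulr0 add0r mul1r.
  apply: le_trans IH; rewrite /G big_ord_recr /= -/(G k).
  have H : iter k Pop (fun y => - b + g * Pop f2 y) x <= iter k Pop f2 x by exact: iter_Pop_le.
  rewrite [leLHS]iter_Pop_distn evD evZ ev_cst -?iter_Pop_distn -?iterSr in H; last first.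
    by apply: distn_is_prob; apply: dirac_is_prob.
  have gk : 0 <= g ^+ k by rewrite exprn_ge0// ltW.
  have := ler_wpM2l gk H; rewrite exprS /=.
  move: (iter k _ _ _) (Pop _ _) (G k) (g ^+ k) => u1 u2 u3 u4; nra.
have [s1 Hs1] := finfun_max s f1; have [s2 Hs2] := finfun_min s f2.
suff: f1 s1 - f2 s2 <= B * (m%:R / q) + 2 * b / (1 - g) + w.
  by have := Hs1 s; have := Hs2 s'; lra.
have GE : (1 - g) * G m = 1 - g ^+ m.
  by rewrite -[1 in RHS](expr1n _ m) subrXX; congr (_ * _); apply: eq_bigr => i _; rewrite expr1n mul1r.
have Gm : G m <= m%:R.
  rewrite -[m in leRHS]card_ord -sumr_const; apply: ler_sum => i _.
  by rewrite exprn_ile1// ltW.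
have gm0 : 0 <= g ^+ m by rewrite exprn_ge0// ltW.
have gm1 : g ^+ m < 1 by rewrite exprn_ilt1 ?ltW//; case: (m) m0.
have e1 := i1 m s1; have e2 := i2 m s2.
have e3 := ler_wpM2l gm0 (@minorize_le _ _ _ f1 (f1 s1) s1 minm Hs1).
have e4 := ler_wpM2l gm0 (@minorize_ge _ _ _ f2 (f2 s2) s2 minm Hs2).
have e5 : ev psi f1 - ev psi f2 <= w by rewrite -evB; apply: ev_le.
have e6 := ler_wpM2l (mulr_ge0 gm0 (ltW q0)) e5.
set X := leRHS; set D := f1 s1 - f2 s2.
(* The minorization returns [g ^+ m * (1 - q) * D] on the right; moved to the left, it leaves the
   factor [W = 1 - g ^+ m * (1 - q)]. Then [q <= W] turns [B * m] into [B * (m / q)], and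
   [1 - g ^+ m <= W] turns [2 * b * G m] into [2 * b / (1 - g)]. *)
have wq : q <= 1 - g ^+ m * (1 - q).
  have := ler_wpM2r (_ : 0 <= 1 - q) (ltW gm1); rewrite subr_ge0 => /(_ q1); lra.
suff : (1 - g ^+ m * (1 - q)) * D <= (1 - g ^+ m * (1 - q)) * X.
  by rewrite ler_pM2l//; lra.
have LD : (1 - g ^+ m * (1 - q)) * D <= (B + 2 * b) * G m + g ^+ m * q * w.
  rewrite /D; move: e1 e2 e3 e4 e6.
  move: (f1 s1) (f2 s2) (ev _ _) (ev _ _) (iter _ _ _ _) (iter _ _ _ _) => x1 x2 x3 x4 x5 x6.
  lra.
apply: (le_trans LD); rewrite /X; move: wq; set W := 1 - _ * _ => wq.
rewrite [leRHS]mulrDr [_ * (_ + _)]mulrDr mulrDl; apply: lerD; first apply: lerD.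
- apply: (@le_trans _ _ (q * (B * (m%:R / q)))).
    rewrite (_ : q * _ = B * m%:R); first by apply: ler_wpM2l.
    by field; rewrite gt_eqF.
  by apply: ler_wpM2r => //; rewrite mulr_ge0// divr_ge0// ltW.
- have -> : 2 * b * G m = (1 - g ^+ m) * (2 * b / (1 - g)).
    by rewrite -GE; field; rewrite gt_eqF// subr_gt0.
  apply: ler_wpM2r; first by rewrite divr_ge0 ?mulr_ge0// subr_ge0 ltW.
  rewrite /W; have := mulr_ge0 gm0 (ltW q0); lra.
- by apply: ler_wpM2r => //; rewrite /W; lra.
Qed.

End Chain.

(** * Stationary distributions and the average reward *)

Section Stationary.
Variables (R : realType) (S A : finType) (p : S -> A -> S -> R) (pi : policy S A).
Hypothesis pP : forall s a, is_prob (p s a).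
Variables (m : nat) (q : R) (psi : S -> R).
Hypothesis minm : minorizes p pi m q psi.
Variables (s0 : S) (mu : S -> R).
Hypothesis muP : is_prob mu.

Let U f t := fmax s0 (iter t (Pop p pi) f).
Let L f t := fmin s0 (iter t (Pop p pi) f).

Let LU f t : L f t <= U f t.
Proof. exact: le_trans (fmin_le s0 _ s0) (fmax_ge s0 _ s0). Qed.

Let U_noninc f : nonincreasing_seq (U f).
Proof.
apply/nonincreasing_seqP => t; apply: ev_le => [|s]; last exact: fmax_ge.
by apply: pP.
Qed.

Let L_nondec f : nondecreasing_seq (L f).
Proof.
apply/nondecreasing_seqP => t; apply: ev_ge => [|s]; last exact: fmin_le.
by apply: pP.
Qed.

Let gap_contract f t : U f (m + t) - L f (m + t) <= (1 - q) * (U f t - L f t).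
Proof.
have h1 : U f (m + t) <= q * ev psi (iter t (Pop p pi) f) + (1 - q) * U f t.
  rewrite /U {1}/fmax; case: cid => s1 /= _; rewrite iterD.
  by apply: minorize_le => // s; apply: fmax_ge.
have h2 : q * ev psi (iter t (Pop p pi) f) + (1 - q) * L f t <= L f (m + t).
  rewrite /L {2}/fmin; case: cid => s1 /= _; rewrite iterD.
  by apply: minorize_ge => // s; apply: fmin_le.
lra.
Qed.

(** The oscillation is nonincreasing and nonnegative, hence has a limit [l]; [gap_contract] passes
    to the limit as [l <= (1 - q) * l], which forces [l = 0]. *)
Let gap_cvg0 f : (fun t => U f t - L f t) @ \oo --> (0 : R).
Proof.
set D := fun t => _.
have D_noninc : nonincreasing_seq D.
  by move=> t t' tt'; apply: lerB; [exact: U_noninc|exact: L_nondec].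
have D0 t : 0 <= D t by rewrite subr_ge0.
have Dl : D @ \oo --> limn D.
  apply: nonincreasing_is_cvgn => //.
  by exists 0 => _ [t _ <-]; apply: D0.
have l0 : 0 <= limn D by apply: limr_ge; [exact: Dl|near=> t; exact: D0].
have Dm : (fun t => D (t + m)%N) @ \oo --> limn D by rewrite cvg_shiftn.
have lq : limn D <= (1 - q) * limn D.
  have Dq : (fun t => (1 - q) * D t) @ \oo --> (1 - q) * limn D by exact: cvgMl_tmp.
  by apply: ler_cvg_to Dm Dq _; near=> t; rewrite /= addnC; apply: gap_contract.
have [_ [/andP[q0 _] _]] := minm.
have l00 : limn D = 0 by apply/eqP; rewrite eq_le l0 andbT; nra.
by rewrite -[X in _ --> X]l00.
Unshelve. all: by end_near. Qed.

Let ev_LU f t : L f t <= ev (distn p pi mu t) f <= U f t.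
Proof.
rewrite ev_distn_iter; apply/andP; split.
  by apply: ev_ge => // s; apply: fmin_le.
by apply: ev_le => // s; apply: fmax_ge.
Qed.

Let ev_distn_cvg f : cvgn (fun t => ev (distn p pi mu t) f).
Proof.
have Ul : U f @ \oo --> limn (U f).
  apply: nonincreasing_is_cvgn; first exact: U_noninc.
  exists (L f 0%N) => _ [t _ <-]; apply: le_trans (LU f t).
  exact: L_nondec.
have Ll : L f @ \oo --> limn (U f).
  have -> : L f = (fun t => U f t - (U f t - L f t)) by apply/funext => t; lra.
  by rewrite -[X in _ --> X]subr0; apply: cvgB.
apply/cvg_ex; exists (limn (U f)).
by apply: (@squeeze_cvgr _ _ _ _ (L f) (U f)) => //; near=> t; apply: ev_LU.
Unshelve. all: by end_near. Qed.

(** [rho] is the pointwise limit of the distributions, which exists by [ev_distn_cvg] applied to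
    indicators. Invariance comes from shifting time by one, and the average reward is a Cesaro mean
    of a convergent sequence. *)
Lemma stationary_avg_reward : exists rho : S -> R, [/\ is_prob rho,
  forall f, ev rho (Pop p pi f) = ev rho f &
  forall r, avg_reward r p mu pi = ev rho (fun s => r s (pi s))].
Proof.
pose rho s' := limn (fun t => distn p pi mu t s').
have rho_cvg s' : (fun t => distn p pi mu t s') @ \oo --> rho s'.
  suff -> : (fun t => distn p pi mu t s') =
      (fun t => ev (distn p pi mu t) (fun s => (s == s')%:R)).
    suff <- : limn (fun t => ev (distn p pi mu t) (fun s => (s == s')%:R)) = rho s' by apply: ev_distn_cvg.
    rewrite /rho; congr (limn _); apply/funext => t.
    rewrite /ev (bigD1 s')//= eqxx mulr1 big1 ?addr0// => s /negPf ->.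
    by rewrite mulr0.
  apply/funext => t.
  rewrite /ev (bigD1 s')//= eqxx mulr1 big1 ?addr0// => s /negPf ->.
  by rewrite mulr0.
have rho_ev f : (fun t => ev (distn p pi mu t) f) @ \oo --> ev rho f.
  apply: cvg_big => [|s _]; first exact: add_continuous.
  by apply: cvgMr_tmp; exact: rho_cvg.
exists rho; split.
- split=> [s|].
    apply: limr_ge; first exact: rho_cvg.
    by near=> t; case: (distn_is_prob pi pP t muP).
  have -> : \sum_s rho s = ev rho (fun=> 1) by apply: eq_bigr => s _; rewrite mulr1.
  apply: cvg_unique (rho_ev (fun=> 1)) _ => //.
  have -> : (fun t => ev (distn p pi mu t) (fun=> 1)) = (fun=> 1).
    by apply/funext => t; rewrite ev_cst//; apply: distn_is_prob.
  exact: cvg_cst.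
- move=> f; apply: cvg_unique (rho_ev (Pop p pi f)) _ => //.
  have -> : (fun t => ev (distn p pi mu t) (Pop p pi f)) = (fun t => ev (distn p pi mu t.+1) f).
    by apply/funext => t; rewrite ev_distnS.
  have := rho_ev f; rewrite -cvg_shiftS; exact.
- move=> r; apply: cvg_lim => //.
  have := cesaro (rho_ev (fun s => r s (pi s))).
  suff -> : arithmetic_mean (fun t => ev (distn p pi mu t) (fun s => r s (pi s))) =
    (fun T => T.+1%:R^-1 * \sum_(t < T.+1) exp_reward r p pi mu t) by [].
  by apply/funext => T; rewrite /arithmetic_mean /= /series /= big_mkord.
Unshelve. all: by end_near. Qed.

End Stationary.

(** * From one-step deviations to the optimality gap *)

Section Core.
Variables (R : realType) (S : finType).
Implicit Types (pr v : S -> R).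

Definition var pr v : R := ev pr (fun s => v s ^+ 2) - ev pr v ^+ 2.

Lemma varE pr v c : is_prob pr -> var pr v = ev pr (fun s => (v s - c) ^+ 2) - (ev pr v - c) ^+ 2.
Proof.
move=> prP; rewrite /var.
rewrite (@eq_ev _ _ pr (fun s => (v s - c) ^+ 2) (fun s => v s ^+ 2 - (2 * c * v s - c ^+ 2))); last first.
  by move=> s; ring.
by rewrite !evB evZ ev_cst//; ring.
Qed.

Lemma var_ge0 pr v : is_prob pr -> 0 <= var pr v.
Proof.
move=> prP; rewrite (@varE _ _ (ev pr v))// subrr expr0n subr0.
by apply: ev_ge => // s; rewrite sqr_ge0.
Qed.

(* Since [v s >= g * ev ph v], the identity g^2 var = g^2 P phi - (g (M - P v))^2 telescopes
   up to the term linear in the deviation, which [a * 2D <= 2/15] absorbs. *)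
Lemma deviation_potential pr (v : S -> R) s (g M D b x : R) :
  is_prob pr -> 18 / 19 <= g < 1 ->
  (forall s', v s' <= M) -> (forall s', M - v s' <= D) ->
  (1 - g) * M <= 2 -> (1 - g) * D <= 2 -> 0 <= b ->
  g * x <= v s ->
  `|x - ev pr v| <= (1 - g) / 40 * var pr v + b ->
  `|x - ev pr v| <= (1 - g) / 30 * (g * ev pr (fun s' => (M - v s') ^+ 2) - (M - v s) ^+ 2)
                    + (2 / 15 * (D * (1 - g)) + 17 / 15 * b).
Proof.
move=> prP /andP[g0 g1] vM vD hM hD b0 gx.
set e := `|_|; set h := 1 - g in hM hD *; set phi := ev _ _ => He.
have e0 : 0 <= e by exact: normr_ge0.
have xe : ev pr v - e <= x by have := ler_norm (- (x - ev pr v)); rewrite normrN -/e; lra.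
have D0 : 0 <= D by have := vM s; have := vD s; lra.
have var0 := var_ge0 v prP.
have varM : var pr v = phi - (M - ev pr v) ^+ 2.
  rewrite (@varE _ _ M)//; congr (_ - _); last by ring.
  by apply: eq_ev => s'; ring.
have phi0 : 0 <= phi by apply: ev_ge => // s'; rewrite sqr_ge0.
set y := M - v s; set Y := M - ev pr v in varM *.
have y0 : 0 <= y by rewrite subr_ge0.
have yD : y <= D by exact: vD.
have gY : y - 2 - e <= g * Y.
  have -> : g * Y = M - h * M - g * ev pr v by rewrite /Y /h; ring.
  have : g * e <= e by rewrite ler_piMl// ltW.
  have : g * (ev pr v - e) <= g * x by rewrite ler_wpM2l//; lra.
  rewrite /y mulrBr; lra.
(* Squaring [gY] requires [y - 2 - e >= 0]; otherwise [y <= 2 + e] already makes the left-hand side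
   nonpositive. *)
have sq : y ^+ 2 - 2 * y * (2 + e) <= (g * Y) ^+ 2.
  have [le0|gt0] := lerP (y - 2 - e) 0.
    have: 0 <= (g * Y) ^+ 2 by rewrite sqr_ge0.
    nra.
  have : (y - 2 - e) ^+ 2 <= (g * Y) ^+ 2 by rewrite lerXn2r ?nnegrE; lra.
  have : 0 <= (2 + e) ^+ 2 by rewrite sqr_ge0.
  nra.
have gv : g ^+ 2 * var pr v <= g * phi - y ^+ 2 + 2 * D * (2 + e).
  have -> : g ^+ 2 * var pr v = g ^+ 2 * phi - (g * Y) ^+ 2 by rewrite varM; ring.
  have : g ^+ 2 * phi <= g * phi by rewrite ler_wpM2r// expr2 ler_piMl; lra.
  have : 2 * y * (2 + e) <= 2 * D * (2 + e) by rewrite ler_wpM2r; lra.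
  lra.
have h0 : 0 < h by rewrite /h; lra.
have g2 : 17 / 19 <= g ^+ 2 by nra.
(* Raising the coefficient of the variance from [1 / 40] to [1 / 30] pays for the factor [17 / 15]
   and for [g ^+ 2 >= 17 / 19], since [17 / 600 <= 17 / 570]. *)
have c1 : (1 + 2 * D * (h / 30)) * (h / 40) <= h / 30 * g ^+ 2.
  have : (1 + 2 * D * (h / 30)) * (h / 40) <= 17 / 15 * (h / 40).
    by rewrite ler_wpM2r//; lra.
  have : h / 30 * (17 / 19) <= h / 30 * g ^+ 2 by rewrite ler_wpM2l//; lra.
  lra.
have c2 := ler_wpM2r var0 c1.
have k0 : 0 <= 1 + 2 * D * (h / 30) by nra.
have c3 := ler_wpM2l k0 He.
have c4 : h / 30 * (g ^+ 2 * var pr v) <= h / 30 * (g * phi - y ^+ 2 + 2 * D * (2 + e)).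
  by rewrite ler_wpM2l//; lra.
have c5 : (1 + 2 * D * (h / 30)) * b <= 17 / 15 * b by rewrite ler_wpM2r//; lra.
move: c2 c3 c4 c5; move: (var pr v) => V.
lra.
Qed.

End Core.

(** * Lower bounds on the minorization time *)

Section MixingTime.
Variables (R : realType) (S A : finType) (p : S -> A -> S -> R).
Hypothesis erg : uniformly_ergodic p.

Lemma tminorize_pi_ge (pi : policy S A) (c : R) :
  (forall m q psi, minorizes p pi m q psi -> c <= m%:R / q) -> c <= tminorize_pi p pi.
Proof.
move=> H; apply: lb_le_inf.
  by have [m [q [psi h]]] := erg pi; exists (m%:R / q), m, q, psi.
by move=> _ [m [q [psi [h ->]]]]; exact: H h.
Qed.

(** An estimate proved for every minorization of a single policy passes to the infimum and then to
    the maximum; this is how [m / q] becomes [tminorize] in the span bound. *)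
Lemma tminorize_ge (pi : policy S A) (c : R) :
  (forall m q psi, minorizes p pi m q psi -> c <= m%:R / q) -> c <= tminorize p.
Proof.
move=> /tminorize_pi_ge /le_trans; apply.
exact: (le_bigmax _ (fun pi => tminorize_pi p pi) pi).
Qed.

Lemma tminorize_ge1 (a0 : A) : 1 <= tminorize p.
Proof.
apply: (@tminorize_ge [ffun=> a0]) => m q psi [m0 [/andP[q0 q1] _]].
by rewrite ler_pdivlMr// mul1r (le_trans q1)// ler1n.
Qed.

End MixingTime.

(** * Planning with an approximate kernel *)

Section Planning.
Variables (R : realType) (S A : finType) (p ph : S -> A -> S -> R).
Hypotheses (pP : forall s a, is_prob (p s a)) (phP : forall s a, is_prob (ph s a)).
Hypothesis erg : uniformly_ergodic p.
Variables (g : R) (Rw : S -> A -> R) (v : S -> R) (pi : policy S A) (b : R).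
Hypotheses (gP : 18 / 19 <= g < 1) (RwP : forall s a, 0 <= Rw s a <= 2).
Hypothesis bellman : bellman_fixpoint Rw g ph v.

(** The fixed-point equation is evaluated at a minimiser of [v] for the first bound and at a
    maximiser for the second. *)
Lemma bellman_bounds s : 0 <= v s /\ (1 - g) * v s <= 2.
Proof.
have /andP[g0 g1] := gP; split.
  have [s1 Hs1] := finfun_min s v.
  apply: le_trans (Hs1 s); have [_ [a Ha]] := bellman s1.
  have := ev_ge (phP s1 a) Hs1; have := RwP s1 a.
  rewrite -subr_ge0 => /andP[r0 _] h1.
  have : g * v s1 <= v s1.
    by rewrite -{2}Ha /Qhat -/(ev _ _); have := ler_wpM2l (_ : 0 <= g) h1; lra.
  nra.
have [s1 Hs1] := finfun_max s v.
suff : (1 - g) * v s1 <= 2 by have := ler_wpM2l (_ : 0 <= 1 - g) (Hs1 s); lra.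
have [_ [a Ha]] := bellman s1.
have h1 := ev_le (phP s1 a) Hs1; have := RwP s1 a => /andP[_ r2].
have : v s1 <= 2 + g * v s1.
  by rewrite -{1}Ha /Qhat -/(ev _ _); have := ler_wpM2l (_ : 0 <= g) h1; lra.
lra.
Qed.

Hypothesis greedy : forall s a, Qhat Rw g ph v s a <= Qhat Rw g ph v s (pi s).
Hypothesis b0 : 0 <= b.
Hypothesis dev : forall s a,
  `|ev (ph s a) v - ev (p s a) v| <= (1 - g) / 40 * var (p s a) v + b.
Variable s0 : S.

Let M := fmax s0 v.
Let D := M - fmin s0 v.
Let phi s := (M - v s) ^+ 2.
Let b' := 2 / 15 * (D * (1 - g)) + 17 / 15 * b.

Let vM s : v s <= M. Proof. exact: fmax_ge. Qed.
Let vD s : M - v s <= D. Proof. by rewrite lerB// fmin_le. Qed.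
Let D0 : 0 <= D. Proof. by apply: le_trans (vD s0); rewrite subr_ge0. Qed.

Let hM : (1 - g) * M <= 2.
Proof. by rewrite /M /fmax; case: cid => s1 /= _; case: (bellman_bounds s1). Qed.

Let hD : (1 - g) * D <= 2.
Proof.
have /andP[g0 g1] := gP; apply: le_trans hM; rewrite ler_wpM2l//; first lra.
by rewrite /D /fmin; case: cid => s1 /= _; case: (bellman_bounds s1); lra.
Qed.

Let v_ge s a : Rw s a + g * ev (ph s a) v <= v s.
Proof. by case: (bellman s) => + _; apply. Qed.

Let v_pi s : v s = Rw s (pi s) + g * ev (ph s (pi s)) v.
Proof.
apply/eqP; rewrite eq_le v_ge andbT; have [_ [a <-]] := bellman s.
exact: greedy.
Qed.

Let dev_phi s a : `|ev (ph s a) v - ev (p s a) v| <=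
  (1 - g) / 30 * (g * ev (p s a) phi - phi s) + b'.
Proof.
apply: (deviation_potential (pP s a) gP vM vD hM hD b0); last exact: dev.
by case/andP: (RwP s a) => r0 _; apply: le_trans (v_ge s a); rewrite lerDr.
Qed.

Let span_bound m q psi : minorizes p pi m q psi ->
  D <= 10 / 3 * (m%:R / q) + 34 / 9 * (b / (1 - g)).
Proof.
move=> minm; have /andP[g0 g1] := gP.
have h0 : 0 < 1 - g by lra.
have b'0 : 0 <= b'.
  by rewrite /b' addr_ge0// !mulr_ge0//; lra.
pose a := (1 - g) / 30.
have a0 : 0 <= a by rewrite /a; lra.
have phi0 s : 0 <= phi s by rewrite sqr_ge0.
have phiD s : phi s <= D ^+ 2 by rewrite lerXn2r ?nnegrE ?vD// subr_ge0.
have e_le s : `|g * ev (ph s (pi s)) v - g * ev (p s (pi s)) v| <=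
    a * (g * ev (p s (pi s)) phi - phi s) + b'.
  rewrite -mulrBr normrM ger0_norm; last lra.
  by apply: le_trans (dev_phi s (pi s)); rewrite ler_piMl//; lra.
(* The terms [a * (g * P phi - phi)] of [e_le] cancel against the corrections [a * phi], leaving the
   constant errors [2 + b'] and [- b']. As [0 <= phi <= D ^+ 2], the two functions differ by at most
   [2 * a * D ^+ 2]. *)
have K := @minorize_span _ _ _ p pi pP m q psi g (fun s => v s + a * phi s)
   (fun s => v s - a * phi s) 2 b' (2 * a * D ^+ 2) minm.
have {K} : M - fmin s0 v <= 2 * (m%:R / q) + 2 * b' / (1 - g) + 2 * a * D ^+ 2.
  rewrite {1}/M /fmax /fmin; case: cid => s1 /= _; case: cid => s2 /= _.
  apply: (@le_trans _ _ (v s1 + a * phi s1 - (v s2 - a * phi s2))).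
    by have := mulr_ge0 a0 (phi0 s1); have := mulr_ge0 a0 (phi0 s2); lra.
  apply: K => //; first by apply/andP; split; lra.
  - by rewrite mulr_ge0 ?sqr_ge0//; lra.
  - move=> s; rewrite /Pop evD evZ v_pi; case/andP: (RwP s (pi s)) => _ r2.
    by have := ler_norm (g * ev (ph s (pi s)) v - g * ev (p s (pi s)) v); have := e_le s; lra.
  - move=> s; rewrite /Pop evB evZ v_pi; case/andP: (RwP s (pi s)) => r0 _.
    have := ler_norm (- (g * ev (ph s (pi s)) v - g * ev (p s (pi s)) v)).
    by rewrite normrN; have := e_le s; lra.
  - by move=> s; have := ler_wpM2l a0 (phiD s); lra.
(* The bound is self-referential: [4 / 15 * D] comes from [b'] and at most [2 / 15 * D] from the
   quadratic term, so [3 / 5 * D] remains on the left. *)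
rewrite -/D; have -> : 2 * b' / (1 - g) = 4 / 15 * D + 34 / 15 * (b / (1 - g)).
  by rewrite /b'; field; rewrite gt_eqF.
have -> : 2 * a * D ^+ 2 = ((1 - g) * D) * D / 15 by rewrite /a; field.
have := ler_wpM2r D0 hD; lra.
Qed.

(** The Bellman inequality bounds the reward of the competitor [pi0] by [v - g * P v] plus the
    deviation, and the Bellman equality bounds that of [pi] from below. Under a stationary law
    [v - g * P v] has mean [(1 - g)] times that of [v], and the deviation has mean at most [b']. *)
Lemma planning_gap (pi0 : policy S A) (rho0 rho : S -> R) :
  b <= (1 - g) * tminorize p ->
  is_prob rho0 -> (forall f, ev rho0 (Pop p pi0 f) = ev rho0 f) ->
  is_prob rho -> (forall f, ev rho (Pop p pi f) = ev rho f) ->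
  ev rho0 (fun s => Rw s (pi0 s)) - ev rho (fun s => Rw s (pi s)) <= 12 * ((1 - g) * tminorize p).
Proof.
move=> bt rho0P st0 rhoP st; have /andP[g0 g1] := gP.
have h0 : 0 < 1 - g by lra.
have st_dev (pi1 : policy S A) rho1 : is_prob rho1 -> (forall f, ev rho1 (Pop p pi1 f) = ev rho1 f) ->
    ev rho1 (fun s => `|ev (ph s (pi1 s)) v - ev (p s (pi1 s)) v|) <= b'.
  move=> rho1P st1.
  apply: (le_trans (le_ev rho1P (fun s => dev_phi s (pi1 s)))).
  rewrite evD ev_cst// evZ evB evZ -/(Pop p pi1 phi) st1.
  have : 0 <= ev rho1 phi by apply: ev_ge => // s; rewrite sqr_ge0.
  move=> e0; rewrite gerDr mulr_ge0_le0//; first lra.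
  by rewrite subr_le0 ler_piMl// ltW.
have up : ev rho0 (fun s => Rw s (pi0 s)) <= (1 - g) * M + b'.
  apply: (@le_trans _ _ (ev rho0 (fun s => v s - g * Pop p pi0 v s +
      `|ev (ph s (pi0 s)) v - ev (p s (pi0 s)) v|))).
    apply: le_ev => // s; have := v_ge s (pi0 s); rewrite /Pop.
    set x := ev (ph _ _) v; set y := ev (p _ _) v.
    have : g * (y - x) <= `|x - y|.
      by rewrite distrC (le_trans _ (ler_piMl (normr_ge0 (y - x)) (ltW g1)))// ler_wpM2l ?ler_norm//; lra.
    lra.
  rewrite evD evB evZ st0; have := st_dev _ _ rho0P st0.
  by have := ler_wpM2l (ltW h0) (ev_le rho0P vM); lra.
have lo : (1 - g) * fmin s0 v - b' <= ev rho (fun s => Rw s (pi s)).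
  apply: (@le_trans _ _ (ev rho (fun s => v s - g * Pop p pi v s -
      `|ev (ph s (pi s)) v - ev (p s (pi s)) v|))).
    rewrite evB evB evZ st; have := st_dev _ _ rhoP st.
    by have := ler_wpM2l (ltW h0) (ev_ge rhoP (fmin_le s0 v)); lra.
  apply: le_ev => // s; rewrite {1}v_pi /Pop.
  set x := ev (ph _ _) v; set y := ev (p _ _) v.
  have : g * (x - y) <= `|x - y|.
    by rewrite (le_trans _ (ler_piMl (normr_ge0 (x - y)) (ltW g1)))// ler_wpM2l ?ler_norm//; lra.
  lra.
have Dt : D <= 10 / 3 * tminorize p + 34 / 9 * (b / (1 - g)).
  suff : (D - 34 / 9 * (b / (1 - g))) * 3 / 10 <= tminorize p by lra.
  by apply: (tminorize_ge erg (pi := pi)) => m q psi /span_bound; lra.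
(* The total is [19 / 15 * (1 - g) * D + 34 / 15 * b]; with [b <= (1 - g) * tminorize p] this is at
   most [1522 / 135 < 12] times [(1 - g) * tminorize p]. *)
have := ler_wpM2l (ltW h0) Dt.
have -> : (1 - g) * (10 / 3 * tminorize p + 34 / 9 * (b / (1 - g))) =
   10 / 3 * ((1 - g) * tminorize p) + 34 / 9 * b by field; rewrite gt_eqF.
have := b0.
move: up lo bt; rewrite /b' /D.
move: (fmin s0 v) M (tminorize p) (ev _ _) (ev _ _) => x1 x2 x3 x4 x5.
have -> : (x2 - x1) * (1 - g) = (1 - g) * (x2 - x1) by rewrite mulrC.
lra.
Qed.

End Planning.

(** * Concentration *)

Section Resampling.
Variables (R : realType) (I T : finType) (w : I -> T -> R).
Hypothesis wP : forall i, is_prob (w i).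
Implicit Types (x : {ffun I -> T}).

Definition weight x : R := \prod_i w i (x i).

Definition upd x i y : {ffun I -> T} := [ffun j => if j == i then y else x j].

Lemma weight_ge0 x : 0 <= weight x.
Proof. by apply: prodr_ge0 => i _; case: (wP i). Qed.

Lemma sum_weight : \sum_x weight x = 1.
Proof. by rewrite -bigA_distr_bigA big1// => i _; case: (wP i). Qed.

(** Exchanging the coordinate [x i] with the fresh value [y] is an involution that preserves the
    joint weight of [(x, y)]. *)
Lemma sum_resample i (F : {ffun I -> T} -> R) :
  \sum_x weight x * F x = \sum_x weight x * ev (w i) (fun y => F (upd x i y)).
Proof.
under [RHS]eq_bigr do rewrite mulr_sumr.
rewrite pair_big /=.
pose h (xy : {ffun I -> T} * T) := (upd xy.1 i xy.2, xy.1 i).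
have hK : involutive h.
  case=> x y; congr pair; last by rewrite ffunE eqxx.
  apply/ffunP => j; rewrite !ffunE /=.
  by case: eqP => [->|].
rewrite (reindex_inj (inv_inj hK)) /=.
rewrite -(pair_big xpredT xpredT (fun x y => weight (upd x i y) * (w i (x i) * F (upd (upd x i y) i (x i))))) /=.
apply: eq_bigr => x _.
have E y : weight (upd x i y) * (w i (x i) * F (upd (upd x i y) i (x i))) = weight x * F x * w i y.
  have -> : upd (upd x i y) i (x i) = x.
    by apply/ffunP => j; rewrite !ffunE; case: eqP => [->|].
  rewrite /weight (bigD1 i)//= [in RHS](bigD1 i)//= ffunE eqxx.
  rewrite (eq_bigr (fun j => w j (x j))); first by ring.
  by move=> j /negPf ji; rewrite ffunE ji.
under eq_bigr do rewrite E.
by rewrite -mulr_sumr; case: (wP i) => _ ->; rewrite mulr1.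
Qed.

(* Resampling the coordinates of [l] one at a time : the exponents may depend on all the
   coordinates outside [l]. *)
Lemma sum_expR_le1 (l : seq I) (f : {ffun I -> T} -> T -> R) : uniq l ->
  (forall x i y, i \in l -> f (upd x i y) = f x) ->
  (forall x i, i \in l -> ev (w i) (fun y => expR (f x y)) <= 1) ->
  \sum_x weight x * expR (\sum_(i <- l) f x (x i)) <= 1.
Proof.
elim: l => [|i l IH] /=.
  by move=> _ _ _; under eq_bigr do rewrite big_nil expR0 mulr1; rewrite sum_weight.
move=> /andP[il ul] fu fe; rewrite (sum_resample i).
apply: le_trans (IH ul _ _); last 2 first.
- by move=> x j y jl; apply: fu; rewrite inE jl orbT.
- by move=> x j jl; apply: fe; rewrite inE jl orbT.
apply: ler_sum => x _; apply: ler_wpM2l; first exact: weight_ge0.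
rewrite (@eq_ev _ _ _ _ (fun y => expR (\sum_(j <- l) f x (x j)) * expR (f x y))); last first.
  move=> y; rewrite big_cons fu ?mem_head// ffunE eqxx expRD mulrC; congr (expR _ * _).
  apply: eq_big_seq => j jl; rewrite ffunE; case: eqP => // ji.
  by rewrite -ji jl in il.
by rewrite evZ ler_piMr ?expR_ge0// fe ?mem_head.
Qed.

Lemma weight_chernoff (l : seq I) (f : {ffun I -> T} -> T -> R) (c : R) : uniq l ->
  (forall x i y, i \in l -> f (upd x i y) = f x) ->
  (forall x i, i \in l -> ev (w i) (fun y => expR (f x y)) <= 1) ->
  \sum_(x | c <= \sum_(i <- l) f x (x i)) weight x <= expR (- c).
Proof.
move=> ul fu fe; rewrite -[leRHS]mul1r.
apply: le_trans (ler_wpM2r (expR_ge0 _) (sum_expR_le1 ul fu fe)).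
rewrite mulr_suml big_mkcond; apply: ler_sum => x _.
rewrite -mulrA -expRD; case: ifP => [cx|_].
  by rewrite ler_peMr ?weight_ge0// -expR0 ler_expR subr_ge0.
by rewrite mulr_ge0 ?weight_ge0 ?expR_ge0.
Qed.

Lemma sum_exists_le (J : finType) (B : J -> pred {ffun I -> T}) (c : R) :
  (forall j, \sum_(x | B j x) weight x <= c) ->
  \sum_(x | [exists j, B j x]) weight x <= #|J|%:R * c.
Proof.
move=> Bc; rewrite mulrC mulr_natr -sumr_const.
apply: (@le_trans _ _ (\sum_j \sum_(x | B j x) weight x)); last exact: ler_sum.
rewrite (exchange_big_dep predT)//= [leLHS]big_mkcond; apply: ler_sum => x _.
case: existsP => [[j Bj]|_]; last by apply: sumr_ge0 => j _; exact: weight_ge0.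
by rewrite (bigD1 j)//= lerDl; apply: sumr_ge0 => k _; exact: weight_ge0.
Qed.

End Resampling.

(** * Linearised Bernstein inequality *)

Section Bernstein.
Variables (R : realType) (S : finType).

(** Here [expR u <= (1 - u)^-1], and [1 <= (1 + u + 2 * u ^+ 2) * (1 - u)] because [u <= 1 / 2]. *)
Lemma expR_le_quadratic (u : R) : u <= 1 / 2 -> expR u <= 1 + u + 2 * u ^+ 2.
Proof.
move=> u2; have h : 1 - u <= expR (- u) by have := expR_ge1Dx (- u).
have u0 : 0 < 1 - u by lra.
have : expR u <= (1 - u)^-1 by rewrite -[u in expR u]opprK expRN lef_pV2 ?posrE ?expR_gt0 //.
move=> /le_trans; apply; rewrite -[leLHS]mul1r ler_pdivrMr//.
have -> : (1 + u + 2 * u ^+ 2) * (1 - u) = 1 + u ^+ 2 * (1 - 2 * u) by ring.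
by rewrite lerDl mulr_ge0 ?sqr_ge0//; lra.
Qed.

(** With the variance subtracted inside the exponent, the Chernoff bound gives a deviation linear in
    the variance, without square roots. The sign [e] selects the tail. *)
Lemma bernstein_mgf (pr V : S -> R) (C lam : R) (e : bool) :
  is_prob pr -> (forall s, 0 <= V s <= C) -> 0 <= lam -> lam * C <= 1 / 2 ->
  ev pr (fun s => expR (lam * ((-1) ^+ e * (V s - ev pr V)) - 2 * lam ^+ 2 * var pr V)) <= 1.
Proof.
move=> prP VC lam0 lamC; set m := ev pr V; set s2 := var pr V.
have m0 : 0 <= m by apply: ev_ge => // s; case/andP: (VC s).
have mC : m <= C by apply: ev_le => // s; case/andP: (VC s).
rewrite (@eq_ev _ _ _ _ (fun s => expR (- (2 * lam ^+ 2 * s2)) *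
    expR (lam * ((-1) ^+ e * (V s - m))))); last by move=> s; rewrite expRD mulrC.
rewrite evZ expRN mulrC ler_pdivrMr ?expR_gt0// mul1r.
apply: le_trans (expR_ge1Dx _).
apply: (@le_trans _ _ (ev pr (fun s => 1 + lam * ((-1) ^+ e * (V s - m)) +
   2 * lam ^+ 2 * (V s - m) ^+ 2))).
  apply: le_ev => // s; apply: (le_trans (expR_le_quadratic _)).
    apply: le_trans lamC; rewrite ler_wpM2l//; case/andP: (VC s) => V0 VC'.
    by case: (e); rewrite ?expr1 ?expr0; lra.
  by rewrite !exprMn sqrr_sign mul1r [2 * (_ * _)]mulrA.
rewrite !evD ev_cst// evZ evZ evZ evB ev_cst// -/m subrr !mulr0 addr0.
by rewrite /s2 (varE V m)// subrr expr0n subr0.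
Qed.

(** Replacing [V] by [v] moves each of the two means by at most [d]; the variance doubles, by
    [(x + y) ^+ 2 <= 2 * x ^+ 2 + 2 * y ^+ 2]. *)
Lemma deviation_transfer (pr ph v V : S -> R) (lam c d : R) :
  is_prob pr -> is_prob ph -> 0 <= lam -> (forall s, `|V s - v s| <= d) ->
  `|ev ph V - ev pr V| <= 2 * lam * var pr V + c ->
  `|ev ph v - ev pr v| <= 4 * lam * var pr v + (c + 2 * d + 4 * lam * d ^+ 2).
Proof.
move=> prP phP lam0 Vd H.
have b1 mu : is_prob mu -> `|ev mu V - ev mu v| <= d.
  move=> muP; rewrite -evB ler_norml; apply/andP; split.
    by apply: ev_ge => // s; move: (Vd s); rewrite ler_norml => /andP[].
  by apply: ev_le => // s; move: (Vd s); rewrite ler_norml => /andP[].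
have vV : var pr V <= 2 * var pr v + 2 * d ^+ 2.
  rewrite (varE V (ev pr v))// (varE v (ev pr v))// subrr expr0n subr0.
  apply: (@le_trans _ _ (ev pr (fun s => (V s - ev pr v) ^+ 2))).
    by rewrite gerBl sqr_ge0.
  rewrite -evZ -[X in _ + X](ev_cst _ prP) -evD; apply: le_ev => // s.
  have : (V s - v s) ^+ 2 <= d ^+ 2.
    by rewrite -[leLHS]real_normK ?num_real// lerXn2r ?nnegrE// (le_trans _ (Vd s)).
  have : 0 <= (V s - v s - (v s - ev pr v)) ^+ 2 by rewrite sqr_ge0.
  by move: (ev _ _) => m; nra.
have := ler_wpM2l lam0 vV.
have := b1 _ prP; have := b1 _ phP; move: H.
rewrite !ler_norml => /andP[? ?] /andP[? ?] /andP[? ?] ?; apply/andP; split; lra.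
Qed.

End Bernstein.

(** * Value iteration with one frozen state *)

Section Frozen.
Variables (R : realType) (S A : finType).
Implicit Types (Rw : S -> A -> R) (ph : S -> A -> S -> R) (v : S -> R).

(* [K] steps of value iteration with the value of [s0] frozen at [u]; it ignores the
   transition rows of [s0]. *)
Fixpoint frozen (s0 : S) (u : R) Rw (g : R) ph (K : nat) : S -> R :=
  if K is K'.+1 then
    fun s => if s == s0 then u else \big[Num.max/0]_(a : A) Qhat Rw g ph (frozen s0 u Rw g ph K') s a
  else fun=> 0.

Lemma eq_frozen s0 u Rw g ph ph' K :
  (forall s a, s != s0 -> ph s a = ph' s a) ->
  frozen s0 u Rw g ph K = frozen s0 u Rw g ph' K.
Proof.
move=> E; elim: K => [//|K IH] /=; apply/funext => s; case: ifP => // /negbT ss0.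
by apply: eq_bigr => a _; rewrite /Qhat IH E.
Qed.

Lemma frozen_bounds s0 u Rw g ph K s : (forall s a, is_prob (ph s a)) -> 0 <= g < 1 ->
  (forall s a, 0 <= Rw s a <= 2) -> 0 <= u <= 2 / (1 - g) ->
  0 <= frozen s0 u Rw g ph K s <= 2 / (1 - g).
Proof.
move=> phP /andP[g0 g1] RwP uC; have C0 : 0 <= 2 / (1 - g) by rewrite divr_ge0 ?subr_ge0// ltW.
elim: K s => [|K IH] s /=; first by rewrite lexx.
case: ifP => // _; apply/andP; split; first exact: bigmax_ge_id.
apply: bigmax_le => // a _; rewrite /Qhat -/(ev _ _).
have h : ev (ph s a) (frozen s0 u Rw g ph K) <= 2 / (1 - g).
  by apply: ev_le => // s'; case/andP: (IH s').
have E : 2 / (1 - g) = 2 + g * (2 / (1 - g)) by field; rewrite subr_eq0 gt_eqF.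
by rewrite E; apply: lerD; [case/andP: (RwP s a)|rewrite ler_wpM2l].
Qed.

Lemma frozen_close s0 u Rw Rz g ph v (C d eta : R) K s :
  (forall s a, is_prob (ph s a)) -> 0 <= g < 1 ->
  bellman_fixpoint Rw g ph v -> (forall s, 0 <= v s <= C) ->
  `|u - v s0| <= d -> (forall s a, `|Rz s a - Rw s a| <= eta) ->
  `|frozen s0 u Rz g ph K s - v s| <= g ^+ K * C + d + eta / (1 - g).
Proof.
move=> phP /andP[g0 g1] bell vC ud zeta.
have d0 : 0 <= d by exact: le_trans (normr_ge0 _) ud.
have eta0 (a : A) : 0 <= eta by exact: le_trans (normr_ge0 _) (zeta s a).
have [_ [a1 _]] := bell s; have {}eta0 := eta0 a1.
have h0 : 0 < 1 - g by rewrite subr_gt0.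
have C0 : 0 <= C by case/andP: (vC s) => ? ?; apply: (@le_trans _ _ (v s)).
have eh : 0 <= eta / (1 - g) by rewrite divr_ge0// ltW.
elim: K s => [|K IH] s /=.
  by rewrite expr0 mul1r sub0r normrN ger0_norm; case/andP: (vC s) => // _ ?; rewrite -addrA ler_wpDr// addr_ge0.
have X0 : 0 <= g ^+ K.+1 * C by rewrite mulr_ge0// exprn_ge0.
case: eqP => [->|_]; first by apply: (le_trans ud); rewrite -addrA [d + _]addrC addrA lerDr addr_ge0.
have E a : `|Qhat Rz g ph (frozen s0 u Rz g ph K) s a - Qhat Rw g ph v s a| <= 
    g ^+ K.+1 * C + d + eta / (1 - g).
  rewrite /Qhat -!/(ev _ _) opprD addrACA -mulrBr -evB.
  apply: (le_trans (ler_normD _ _)).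
  have K1 : `|ev (ph s a) (fun s' => frozen s0 u Rz g ph K s' - v s')| <=
      g ^+ K * C + d + eta / (1 - g).
    rewrite ler_norml; apply/andP; split.
      by apply: ev_ge => // s'; move: (IH s'); rewrite ler_norml => /andP[].
    by apply: ev_le => // s'; move: (IH s'); rewrite ler_norml => /andP[].
  have K2 := ler_wpM2l g0 K1.
  have E1 : eta / (1 - g) = eta + g * (eta / (1 - g)) by field; rewrite gt_eqF.
  rewrite normrM (ger0_norm g0) exprS E1.
  have := zeta s a; have : g * d <= d by rewrite ler_piMl// ltW.
  move: K2; rewrite !mulrDr !mulrA; lra.
have [Qle [a Qa]] := bell s.
rewrite ler_norml; apply/andP; split.
  have := E a; rewrite ler_norml Qa => /andP[h _].
  apply: (le_trans h); rewrite lerB//.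
  exact: (le_bigmax _ (fun a => Qhat Rz g ph (frozen s0 u Rz g ph K) s a) a).
(* The default value [0] of the maximum must also respect the bound, which holds as [v s >= 0]. *)
rewrite lerBlDr; apply: bigmax_le => [|a' _].
  by rewrite !addr_ge0//; case/andP: (vC s).
by have := E a'; rewrite ler_norml => /andP[_]; have := Qle a'; lra.
Qed.

End Frozen.

(** * Uniform deviation bound over a net of frozen values *)

Section Samples.
Variables (R : realType) (S A : finType) (p : S -> A -> S -> R) (n : nat).
Hypothesis pP : forall s a, is_prob (p s a).
Hypothesis n0 : (0 < n)%N.
Implicit Types (x : {ffun S * A * 'I_n -> S}) (f : S -> R).

Lemma phat_is_prob (X : S -> A -> nat -> S) s a : is_prob (phat R n X s a).
Proof.
split=> [s'|]; first by rewrite /phat mulr_ge0 ?invr_ge0 ?ler0n// sumr_ge0// => i _; rewrite ler0n.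
rewrite /phat -mulr_sumr exchange_big /=.
rewrite (eq_bigr (fun=> 1)) => [|i _]; last first.
  rewrite (bigD1 (X s a i))//= eqxx big1 ?addr0// => s' /negPf.
  by rewrite eq_sym => ->.
by rewrite sumr_const card_ord mulVf// pnatr_eq0 -lt0n.
Qed.

(* The value at indices beyond [n] is irrelevant. *)
Definition samp x : S -> A -> nat -> S :=
  fun s a i => if insub i is Some j then x (s, a, j) else s.

Lemma ev_phat x s a f : ev (phat R n (samp x) s a) f = n%:R^-1 * \sum_(i < n) f (x (s, a, i)).
Proof.
rewrite /ev /phat; under eq_bigr do rewrite -mulrA mulr_suml.
rewrite -mulr_sumr exchange_big /=; congr (_ * _); apply: eq_bigr => i _.
rewrite (bigD1 (x (s, a, i)))//= /samp insubT ?ltn_ord//= => lt_in.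
have -> : Sub (nat_of_ord i) lt_in = i by exact: val_inj.
rewrite eqxx mul1r big1 ?addr0// => s' /negPf.
by rewrite eq_sym => ->; rewrite mul0r.
Qed.

Variables (Rz : S -> A -> R) (g tau lam L : R) (J K : nat).
Hypotheses (gP : 0 <= g < 1) (RzP : forall s a, 0 <= Rz s a <= 2).
Hypotheses (lam0 : 0 < lam) (lamP : lam * (2 / (1 - g)) <= 1 / 2).
Hypotheses (tau0 : 0 < tau) (Jtau : J.-1%:R * tau <= 2 / (1 - g)).

Let V x (k : S * A * 'I_J * bool) : S -> R :=
  frozen k.1.1.1 (k.1.2%:R * tau) Rz g (phat R n (samp x)) K.

(** The index [k] collects a state, an action, a point of the net of frozen values, and the sign of
    the tail. *)
Definition bern x (k : S * A * 'I_J * bool) (y : S) : R :=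
  lam * ((-1) ^+ k.2 * (V x k y - ev (p k.1.1.1 k.1.1.2) (V x k)))
  - 2 * lam ^+ 2 * var (p k.1.1.1 k.1.1.2) (V x k).

Definition bad x : bool :=
  [exists k : S * A * 'I_J * bool, L <= \sum_(i < n) bern x k (x (k.1.1, i))].

(** The function frozen at [s] is unchanged when samples at [s] are resampled, so the Chernoff bound
    applies to the [n] samples of each pair [(s, a)]. The prefactor counts the indices [k] of the
    union bound. *)
Lemma sum_bad : \sum_(x | bad x) weight (fun sai => p sai.1.1 sai.1.2) x <=
  2 * #|S|%:R * #|A|%:R * J%:R * expR (- L).
Proof.
have wP (sai : S * A * 'I_n) : is_prob (p sai.1.1 sai.1.2) by exact: pP.
apply: (le_trans (sum_exists_le wP (c := expR (- L)) _)); last first.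
  by rewrite !card_prod card_ord card_bool !natrM; lra.
move=> [[[s a] j] e] /=.
set k := (s, a, j, e).
pose l := [seq (s, a, i) | i <- enum 'I_n].
rewrite (eq_bigl (fun x => L <= \sum_(sai <- l) bern x k (x sai))); last first.
  by move=> x; rewrite /l big_map big_enum.
apply: (weight_chernoff wP (f := fun x => bern x k)).
- by rewrite map_inj_uniq ?enum_uniq// => i i' [].
- move=> x sai y /mapP[i _ ->]; apply/funext => y'.
  rewrite /bern /V /= (@eq_frozen _ _ _ s _ _ _ _ (phat R n (samp x)))// => s' a' /negPf ss'.
  apply/funext => s''; rewrite /phat; congr (_ * _); apply: eq_bigr => i' _.
  by rewrite /samp; case: insub => // j'; rewrite ffunE !xpair_eqE ss'.
- move=> x sai /mapP[i _ ->]; apply: bernstein_mgf => //.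
  + move=> s'; apply: frozen_bounds => //; first exact: phat_is_prob.
    rewrite /k /= mulr_ge0 ?(ltW tau0)//=; apply: le_trans Jtau.
    by rewrite ler_wpM2r ?(ltW tau0)// ler_nat -ltnS prednK ?ltn_ord// (leq_ltn_trans _ (ltn_ord j)).
  + exact: ltW.
  + exact: lamP.
Qed.

Lemma good_deviation x (s : S) (a : A) (j : 'I_J) (W : S -> R) : ~~ bad x ->
  W = frozen s (j%:R * tau) Rz g (phat R n (samp x)) K ->
  `|ev (phat R n (samp x) s a) W - ev (p s a) W| <= 2 * lam * var (p s a) W + L / (n%:R * lam).
Proof.
rewrite /bad negb_exists => /forallP good WE.
have n0R : 0 < n%:R :> R by rewrite ltr0n.
have side (e : bool) : (-1) ^+ e * (ev (phat R n (samp x) s a) W - ev (p s a) W) <=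
    2 * lam * var (p s a) W + L / (n%:R * lam).
  have := good (s, a, j, e); rewrite -ltNge /bern /V /= -WE => /ltW.
  rewrite sumrB -mulr_sumr -mulr_sumr sumrB !sumr_const card_ord ev_phat.
  set Sm := \sum_(i < n) _; set m := ev _ _; set s2 := var _ _ => H.
  rewrite -(ler_pM2l (mulr_gt0 n0R lam0)).
  rewrite -[m *+ n]mulr_natl -[_ *+ n]mulr_natl in H.
  have -> : n%:R * lam * (2 * lam * s2 + L / (n%:R * lam)) = n%:R * (2 * lam ^+ 2 * s2) + L.
    by field; rewrite !gt_eqF.
  have -> : n%:R * lam * ((-1) ^+ e * (n%:R^-1 * Sm - m)) = lam * ((-1) ^+ e * (Sm - n%:R * m)).
    by field; rewrite gt_eqF.
  lra.
have := side false; have := side true; rewrite expr0 expr1 mul1r mulN1r => h1 h2.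
by rewrite ler_norml h2 andbT; lra.
Qed.

Variables (Rw : S -> A -> R) (v : S -> R) (x : {ffun S * A * 'I_n -> S}).
Hypotheses (v0 : forall s, 0 <= v s <= 2 / (1 - g)).
Hypothesis bell : bellman_fixpoint Rw g (phat R n (samp x)) v.
Hypotheses (KP : g ^+ K * (2 / (1 - g)) <= tau)
  (RzRw : forall s a, `|Rz s a - Rw s a| <= (1 - g) * tau).
Hypothesis (JP : 2 / (1 - g) < J%:R * tau).

Lemma good_fixpoint_deviation s a : ~~ bad x ->
  `|ev (phat R n (samp x) s a) v - ev (p s a) v| <=
  4 * lam * var (p s a) v + (L / (n%:R * lam) + 2 * (3 * tau) + 4 * lam * (3 * tau) ^+ 2).
Proof.
move=> good; have /andP[g0 g1] := gP.
have /andP[v1 v2] := v0 s.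
have q0 : 0 <= v s / tau by rewrite divr_ge0 ?(ltW tau0).
have /andP[t1 t2] := truncn_itv q0.
rewrite ler_pdivlMr// in t1; rewrite ltr_pdivrMr// in t2.
(* The net point is [v s] rounded down to a multiple of [tau]; [JP] ensures that its index is below
   [J]. *)
have jJ : (Num.truncn (v s / tau) < J)%N.
  by rewrite -(ltr_nat R) -(ltr_pM2r tau0); apply: le_lt_trans JP; apply: le_trans v2.
have := @good_deviation x s a (Ordinal jJ) _ good erefl; rewrite /=.
apply: deviation_transfer => //; [exact: phat_is_prob|exact: ltW|] => s'.
(* One [tau] for stopping value iteration at step [K], one for rounding [v s], and one for the
   reward error [(1 - g) * tau] amplified by [(1 - g)^-1]. *)
have -> : 3 * tau = tau + tau + (1 - g) * tau / (1 - g) by field; rewrite gt_eqF// subr_gt0.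
apply: le_trans (frozen_close (eta := (1 - g) * tau) (d := tau) _ s' (phat_is_prob _) gP bell v0 _ RzRw) _.
  by rewrite ler_norml; apply/andP; split; move: t2; rewrite -natr1 mulrDl mul1r; lra.
by rewrite !lerD2r.
Qed.

End Samples.

(** * Discretisation of the noise *)

Section NoiseGrid.
Variables (R : realType) (S A : finType) (p : S -> A -> S -> R) (n : nat) (zeta delta : R).
Variables (d : measure_display) (Omega : measurableType d) (P : probability Omega R).
Variables (Z : Omega -> S -> A -> R) (X : Omega -> S -> A -> nat -> S).
Hypothesis pP : forall s a, is_prob (p s a).
Hypothesis zeta0 : 0 < zeta.

Let E (lo hi : S -> A -> R) (x : S -> A -> nat -> S) :=
  [set w | (forall s a, lo s a <= Z w s a <= hi s a) /\
           (forall s a i, (i < n)%N -> X w s a i = x s a i)].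

Hypothesis law : forall lo hi x, measurable (E lo hi x) /\
  P (E lo hi x) = ((\prod_(s : S) \prod_(a : A) (overlap zeta (lo s a) (hi s a) / zeta))
            * \prod_(s : S) \prod_(a : A) \prod_(i < n) p s a (x s a i))%:E.

Let W (x : {ffun S * A * 'I_n -> S}) := weight (fun sai => p sai.1.1 sai.1.2) x.

Let prod_W (x : {ffun S * A * 'I_n -> S}) :
  \prod_(s : S) \prod_(a : A) \prod_(i < n) p s a (samp x s a i) = W x.
Proof.
rewrite pair_big /= pair_big /=; apply: eq_bigr => -[[s a] i] _ /=.
rewrite /samp insubT ?ltn_ord//= => lt_in.
by have -> : Sub (nat_of_ord i) lt_in = i by exact: val_inj.
Qed.

Variables (N : nat) (N0 : (0 < N)%N).

(** The lower corner of the cell of side [zeta / N] with index [k]. *)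
Definition grid (k : {ffun S * A -> 'I_N}) (s : S) (a : A) : R := zeta * (k (s, a))%:R / N%:R.

Lemma grid_bounds k s a : 0 <= grid k s a <= zeta.
Proof.
rewrite /grid divr_ge0 ?mulr_ge0 ?ler0n ?(ltW zeta0)//=.
rewrite -mulrA ler_piMr ?(ltW zeta0)// ler_pdivrMr ?ltr0n// mul1r ler_nat.
exact: ltnW (ltn_ord _).
Qed.

Let cell (k : {ffun S * A -> 'I_N}) (x : {ffun S * A * 'I_n -> S}) :=
  E (grid k) (fun s a => grid k s a + zeta / N%:R) (samp x).

(** The noise factor is written as a [weight] for the uniform law on ['I_N], so that [sum_weight]
    sums it to [1] over the cells. *)
Let cell_P k x : P (cell k x) = (weight (fun (_ : S * A) (_ : 'I_N) => N%:R^-1) k * W x)%:E.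
Proof.
rewrite /cell (law _ _ _).2 prod_W /weight; congr (_ * _)%:E.
rewrite pair_big /=; apply: eq_bigr => -[s a] _ /=.
have /andP[g0 g1] := grid_bounds k s a.
have NR : 0 < N%:R :> R by rewrite ltr0n.
have g2 : grid k s a + zeta / N%:R <= zeta.
  rewrite /grid -mulrDl -{2}[zeta]mulr1 -mulrDr -mulrA ler_piMr ?(ltW zeta0)//.
  by rewrite ler_pdivrMr// mul1r natr1 ler_nat.
rewrite /overlap (min_idPl g2) (max_idPl g0) addrC addKr (max_idPr _); last first.
  by rewrite divr_ge0 ?ltW.
by field; rewrite !gt_eqF.
Qed.

Lemma grid_cell (z : S -> A -> R) : (forall s a, 0 <= z s a <= zeta) ->
  exists k, forall s a, grid k s a <= z s a <= grid k s a + zeta / N%:R.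
Proof.
move=> zP; have NR : 0 < N%:R :> R by rewrite ltr0n.
have step m : zeta * m%:R / N%:R + zeta / N%:R = zeta * m.+1%:R / N%:R.
  by rewrite -mulrDl -natr1 mulrDr mulr1.
have H (sa : S * A) : exists j : 'I_N,
    zeta * j%:R / N%:R <= z sa.1 sa.2 <= zeta * j%:R / N%:R + zeta / N%:R.
  case: sa => s a /=; have /andP[z0 z1] := zP s a.
  have q0 : 0 <= z s a * N%:R / zeta by apply: divr_ge0; [apply: mulr_ge0 => //; exact: ltW|exact: ltW].
  have := truncn_itv q0; set t := Num.truncn _ => /andP[t1 t2].
  rewrite ler_pdivlMr// in t1; rewrite ltr_pdivrMr// in t2.
  have [jN|Nj] := ltnP t N.
    exists (Ordinal jN); rewrite /= step.
    by rewrite ler_pdivrMr// ler_pdivlMr// ![zeta * _]mulrC t1 ltW.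
  (* An index [t >= N] occurs only for [z s a = zeta], which belongs to the closed last cell. *)
  have N1 : (N.-1 < N)%N by rewrite prednK.
  exists (Ordinal N1) => /=.
  rewrite step prednK// mulfK ?gt_eqF// z1 andbT.
  rewrite ler_pdivrMr//; apply: le_trans t1; rewrite mulrC ler_wpM2r ?(ltW zeta0)//.
  by rewrite ler_nat (leq_trans (leq_pred _) Nj).
exists [ffun sa => sval (cid (H sa))] => s a; rewrite /grid ffunE.
exact: (svalP (cid (H (s, a)))).
Qed.

Variable bd : {ffun S * A -> 'I_N} -> pred {ffun S * A * 'I_n -> S}.
Hypothesis bdP : forall k, \sum_(x | bd k x) W x <= delta.

(* On each cell of a grid of noise values the bad samples may depend on the cell but not on
   the noise, so independence is only used on finitely many boxes. *)
Lemma good_event : exists F : set Omega, [/\ measurable F, ((1 - delta)%:E <= P F)%E &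
  forall w, F w -> exists k x,
    [/\ forall s a, 0 <= Z w s a <= zeta,
        forall s a, grid k s a <= Z w s a <= grid k s a + zeta / N%:R,
        forall s a i, (i < n)%N -> X w s a i = samp x s a i & ~~ bd k x]].
Proof.
have wP (sai : S * A * 'I_n) : is_prob (p sai.1.1 sai.1.2) by exact: pP.
have NR : 0 < N%:R :> R by rewrite ltr0n.
pose full (x : {ffun S * A * 'I_n -> S}) := E (fun _ _ => 0) (fun _ _ => zeta) (samp x).
(* [F1] restricts the noise to [[0, zeta]]; the boxes [full x] are disjoint and their probabilities
   sum to [1]. *)
pose F1 := \bigcup_(x in [set` enum {ffun S * A * 'I_n -> S}]) full x.
pose rb := enum [pred kx : {ffun S * A -> 'I_N} * {ffun S * A * 'I_n -> S} | bd kx.1 kx.2].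
(* Closed cells share faces, so the probability of [F2] is bounded by subadditivity. *)
pose F2 := \bigcup_(kx in [set` rb]) cell kx.1 kx.2.
have mF1 : measurable F1 by apply: fin_bigcup_measurable => // x _; exact: (law _ _ _).1.
have mF2 : measurable F2 by apply: fin_bigcup_measurable => // x _; exact: (law _ _ _).1.
have PF1 : P F1 = 1%E.
  rewrite measure_fin_bigcup//; last 2 first.
  - move=> x y _ _ [w [[_ wx] [_ wy]]]; apply/ffunP => -[[s a] i].
    have := wx s a i (ltn_ord i); rewrite wy// /samp insubT ?ltn_ord//= => lt_in.
    by have -> : Sub (nat_of_ord i) lt_in = i by exact: val_inj.
  - by move=> x _; exact: (law _ _ _).1.
  rewrite -(fsbig_seq _ _ (enum_uniq _)) big_enum /=.
  rewrite (eq_bigr (fun x => (W x)%:E)).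
    by rewrite sumEFin sum_weight.
  move=> x _; rewrite /full (law _ _ _).2 prod_W big1 ?mul1r// => s _.
  rewrite big1// => a _; rewrite /overlap minxx maxxx subr0 (max_idPr (ltW zeta0)).
  by rewrite divff// gt_eqF.
have PF2 : (P F2 <= delta%:E)%E.
  apply: (@le_trans _ _ (\sum_(kx \in [set` rb]) P (cell kx.1 kx.2))%E).
    by apply: content_sub_fsum => // kx _; exact: (law _ _ _).1.
  rewrite -(fsbig_seq _ _ (enum_uniq _)) big_enum /=.
  rewrite (eq_bigr (fun kx => (weight (fun (_ : S * A) (_ : 'I_N) => N%:R^-1) kx.1 * W kx.2)%:E)); last first.
    by move=> kx _; exact: cell_P.
  rewrite sumEFin lee_fin.
  rewrite -(pair_big_dep xpredT bd (fun k x => weight (fun (_ : S * A) (_ : 'I_N) => N%:R^-1) k * W x)) /=.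
  have uP (sa : S * A) : is_prob (fun _ : 'I_N => N%:R^-1 : R).
    split=> [_|]; first by rewrite invr_ge0 ltW.
    by rewrite sumr_const card_ord -[LHS]mulr_natl divff// gt_eqF.
  rewrite -[leRHS]mul1r -[X in _ <= X * _](sum_weight uP) mulr_suml; apply: ler_sum => k _.
  by rewrite -mulr_sumr; apply: ler_wpM2l; [exact: weight_ge0|exact: bdP].
exists (F1 `\` F2); split.
- exact: measurableD.
- have -> : P (F1 `\` F2) = (P F1 - P (F1 `&` F2))%E.
    by apply: measureD => //; apply: le_lt_trans (probability_le1 P mF1) (ltry 1).
  rewrite PF1 EFinB leeB// (le_trans _ PF2)//.
  by apply: le_measure; rewrite ?inE; [exact: measurableI|exact: mF2|move=> w []].
- move=> w [[x _ [Zw Xw]] nF2].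
  have [k kP] := grid_cell Zw; exists k, x; split=> //.
  apply/negP => bkx; apply: nF2; exists (k, x) => //=.
  by rewrite mem_enum.
Qed.

End NoiseGrid.

(** * Calibration of gamma, zeta and n *)

(** The constant is [944784]; the lower bound serves the accuracy, the upper bound the sample
    count. *)
Lemma c_const_bounds (R : realType) : 10 ^+ 5 <= c_const R <= 10 ^+ 6.
Proof. by rewrite /c_const; apply/andP; split; lra. Qed.

Section Calibration.
Variables (R : realType) (nS nA : nat) (eps delta t : R).
Hypotheses (nS0 : (0 < nS)%N) (nA0 : (0 < nA)%N).
Hypotheses (epsP : 0 < eps <= 1) (deltaP : 0 < delta < 1) (t1 : 1 <= t).

Let g := gamma_of eps t.
Let h := 1 - g.
Let zeta := zeta_of g t.
Let beta := beta_of nS nA g delta (eta_star nS nA zeta delta g).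
Let n := n_of nS nA eps delta t.
(* [Y] is the argument of the logarithm in [beta], with [eta_star] and [zeta] substituted. *)
Let Y := 24 * 36 * nS%:R ^+ 2 * nA%:R ^+ 3 * log2 h^-1 / (h ^+ 4 * t * delta ^+ 2).

Lemma one_sub_gammaE : h = eps / (19 * t).
Proof. by rewrite /h /g /gamma_of opprB addrC subrK. Qed.

Lemma one_sub_gamma_mul : h * t = eps / 19.
Proof. by have t1' := t1; rewrite one_sub_gammaE; field; rewrite gt_eqF//; lra. Qed.

Lemma one_sub_gamma_bounds : 0 < h <= 1 / 19.
Proof.
have t1' := t1; have /andP[e0 e1] := epsP; rewrite one_sub_gammaE; apply/andP; split; first by rewrite divr_gt0// mulr_gt0//; lra.
by rewrite ler_pdivrMr ?mulr_gt0//; lra.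
Qed.

Lemma zeta_ofE : zeta = eps / 76.
Proof. by rewrite /zeta /zeta_of -/h one_sub_gamma_mul; field. Qed.

Lemma half_le_ln2 : 1 / 2 <= ln 2 :> R.
Proof.
rewrite -[leLHS]expRK ler_ln ?posrE ?expR_gt0//.
by apply: le_trans (expR_le_quadratic _) _ => //; lra.
Qed.

Let ns1 : 1 <= nS%:R :> R. Proof. by rewrite ler1n. Qed.
Let na1 : 1 <= nA%:R :> R. Proof. by rewrite ler1n. Qed.

Let hV : 19 <= h^-1.
Proof.
have t1' := t1; have /andP[h0 h1] := one_sub_gamma_bounds.
by rewrite -[19]invrK lef_pV2 ?posrE ?invr_gt0//; lra.
Qed.

Let log2_ge1 : 1 <= log2 h^-1.
Proof.
have hV' := hV; have l2 := half_le_ln2; rewrite /log2 ler_pdivlMr ?mul1r; last lra.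
by rewrite ler_ln ?posrE//; have := hV; lra.
Qed.

Let log2_le : log2 h^-1 <= 2 * h^-1.
Proof.
have hV' := hV; have l2 := half_le_ln2; rewrite /log2 ler_pdivrMr; last lra.
have hV0 : 0 < h^-1 by have := hV; lra.
have : ln h^-1 <= h^-1.
  have h1 : -1 < h^-1 - 1 by lra.
  by have := le_ln1Dx h1; rewrite (_ : 1 + (h^-1 - 1) = h^-1); [lra|ring].
by move=> /le_trans; apply; rewrite -mulrA mulrCA ler_peMr ?(ltW hV0)//; lra.
Qed.

Lemma beta_ofE : beta = 2 * ln Y.
Proof.
have t1' := t1; have s1' := ns1; have a1' := na1; have /andP[h0 h1] := one_sub_gamma_bounds; have /andP[d0 d1] := deltaP.
rewrite /beta /beta_of /eta_star -/h /zeta /zeta_of -/h; congr (2 * ln _); rewrite /Y.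
by field; rewrite !gt_eqF//; lra.
Qed.

(** Shaped for the union bound, which runs over at most [42 * nS * nA / h ^+ 2] events. *)
Lemma beta_arg_ge : 24 * 36 * nS%:R * nA%:R / (h ^+ 2 * delta) <= Y.
Proof.
have t1' := t1; have s1' := ns1; have a1' := na1; have /andP[h0 h1] := one_sub_gamma_bounds; have /andP[d0 d1] := deltaP; have /andP[e0 e1] := epsP.
have hht : h ^+ 4 * t * delta ^+ 2 <= h ^+ 2 * delta.
  have -> : h ^+ 4 * t * delta ^+ 2 = (h ^+ 2 * delta) * (h * delta * (h * t)) by ring.
  have hd1 : h * delta <= 1 by rewrite mulr_ile1//; lra.
  have hd0 : 0 <= h * delta by rewrite mulr_ge0//; lra.
  have htb : 0 <= h * t <= 1 by rewrite one_sub_gamma_mul; lra.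
  have hhd : 0 <= h ^+ 2 * delta by rewrite mulr_ge0 ?exprn_ge0//; lra.
  by rewrite ler_piMr// mulr_ile1//; lra.
rewrite /Y; apply: ler_pM.
- by rewrite !mulr_ge0//; lra.
- by rewrite invr_ge0 mulr_ge0 ?exprn_ge0//; lra.
- have e2 : nS%:R <= nS%:R ^+ 2 :> R by rewrite expr2 ler_peMr//; lra.
  have e3 : nA%:R <= nA%:R ^+ 3 :> R by rewrite exprS ler_peMr ?exprn_ege1//; lra.
  have sa0 : 0 <= nS%:R * nA%:R :> R by rewrite mulr_ge0//; lra.
  have sa : nS%:R * nA%:R <= nS%:R ^+ 2 * nA%:R ^+ 3 :> R by apply: ler_pM => //; lra.
  apply: (@le_trans _ _ (24 * 36 * nS%:R ^+ 2 * nA%:R ^+ 3)); first lra.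
  by rewrite ler_peMr//; lra.
- rewrite lef_pV2// posrE ?mulr_gt0 ?exprn_gt0//; lra.
Qed.

Let Y_ge1 : 1 < Y.
Proof.
have t1' := t1; have s1' := ns1; have a1' := na1; have /andP[h0 h1] := one_sub_gamma_bounds; have /andP[d0 d1] := deltaP.
apply: lt_le_trans beta_arg_ge; rewrite ltr_pdivlMr ?mul1r ?mulr_gt0 ?exprn_gt0//.
have : h ^+ 2 * delta <= 1 by rewrite mulr_ile1 ?exprn_ge0 ?exprn_ile1//; lra.
have : 1 <= nS%:R * nA%:R :> R by rewrite mulr_ege1.
by rewrite -mulrA; lra.
Qed.

Lemma beta_of_gt0 : 0 < beta.
Proof. by rewrite beta_ofE mulr_gt0// ln_gt0. Qed.

(** As [beta = 2 * ln Y], the exponential is [Y^-1 * Y^-1]. One factor is bounded by [1]; the other,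
    by [beta_arg_ge], already leaves [42 / 864 * delta]. *)
Lemma union_bound_le_delta (J : R) : 0 <= J <= 21 / h ^+ 2 ->
  2 * nS%:R * nA%:R * J * expR (- beta) <= delta.
Proof.
move=> /andP[J0 J1].
have /andP[h0 h1] := one_sub_gamma_bounds; have /andP[d0 d1] := deltaP.
have Y0 : 0 < Y by apply: lt_trans Y_ge1.
have -> : expR (- beta) = Y^-1 * Y^-1.
  by rewrite beta_ofE expRN mulr_natl mulr2n expRD lnK ?posrE// invfM.
have sa0 : 0 < nS%:R * nA%:R :> R by rewrite mulr_gt0 ?ltr0n.
have Yi : Y^-1 <= h ^+ 2 * delta / (24 * 36 * nS%:R * nA%:R).
  have -> : h ^+ 2 * delta / (24 * 36 * nS%:R * nA%:R) = (24 * 36 * nS%:R * nA%:R / (h ^+ 2 * delta))^-1.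
    by rewrite invf_div.
  rewrite lef_pV2 ?posrE//; first exact: beta_arg_ge.
  by rewrite divr_gt0 ?mulr_gt0 ?exprn_gt0 ?ltr0n.
have Yi1 : Y^-1 <= 1 by rewrite invf_le1// ltW.
apply: (@le_trans _ _ (2 * nS%:R * nA%:R * (21 / h ^+ 2) * (h ^+ 2 * delta / (24 * 36 * nS%:R * nA%:R)))).
  apply: ler_pM => //; rewrite ?mulr_ge0 ?invr_ge0 ?(ltW Y0)//.
    by rewrite ler_wpM2l ?mulr_ge0.
  by apply: le_trans Yi; rewrite ler_piMr// invr_ge0 ltW.
have -> : 2 * nS%:R * nA%:R * (21 / h ^+ 2) * (h ^+ 2 * delta / (24 * 36 * nS%:R * nA%:R)) = 42 / (24 * 36) * delta.
  by field; rewrite !gt_eqF ?ltr0n.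
lra.
Qed.

Let nx := c_const R * beta / (h ^+ 2 * t).
Let nx0 : 0 < nx.
Proof.
have t1' := t1; have s1' := ns1; have a1' := na1; have /andP[h0 _] := one_sub_gamma_bounds; have b0 := beta_of_gt0.
have /andP[c0 _] := c_const_bounds R.
have {}c0 : 0 < c_const R by apply: lt_le_trans c0; rewrite exprn_gt0.
apply: divr_gt0; first exact: mulr_gt0 c0 b0.
by apply: mulr_gt0; [rewrite exprn_gt0|lra].
Qed.

Let n_absz : n%:R = (Num.ceil nx)%:~R :> R.
Proof.
rewrite /n /n_of -/g -/zeta -/beta -/h -/nx natr_absz ger0_norm//.
have := ceil_ge nx; have := nx0; rewrite -(ler_int R); lra.
Qed.

Lemma n_of_ge : c_const R * beta / (h ^+ 2 * t) <= n%:R.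
Proof. by rewrite n_absz ceil_ge. Qed.

Lemma n_of_le : n%:R <= c_const R * beta / (h ^+ 2 * t) + 1.
Proof. by rewrite n_absz; have := ceilB1_lt nx; rewrite intrB -/nx; lra. Qed.

Lemma n_of_gt0 : (0 < n)%N.
Proof. by rewrite -(ltr_nat R); apply: lt_le_trans nx0 n_of_ge. Qed.

Lemma sample_complexity : (nS * nA * n)%:R <=
  10 ^+ 11 * nS%:R * nA%:R * t / eps ^+ 2 *
    (1 + ln (nS%:R * nA%:R * t / (eps * delta))).
Proof.
have t1' := t1; have s1' := ns1; have a1' := na1; have /andP[h0 h1] := one_sub_gamma_bounds; have /andP[d0 d1] := deltaP; have /andP[e0 e1] := epsP.
set s := nS%:R in s1' *; set a := nA%:R in a1' *.
set Q := s * a * t / (eps * delta).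
have sa1 : 1 <= s * a by rewrite mulr_ege1.
have sat : 1 <= s * a * t by rewrite mulr_ege1.
have ed0 : 0 < eps * delta by rewrite mulr_gt0.
have ed1 : eps * delta <= 1 by rewrite mulr_ile1; lra.
have QE : Q = s * a * t * (delta^-1 * eps^-1) by rewrite /Q invfM [_^-1 * _]mulrC.
have ei1 : 1 <= eps^-1 by rewrite invf_ge1.
have di1 : 1 <= delta^-1 by rewrite invf_ge1// ltW.
have Q1 : 1 <= Q by rewrite QE !mulr_ege1.
have Qd : delta^-1 <= Q.
  by rewrite QE mulrCA ler_peMr ?invr_ge0 ?(ltW d0)// mulr_ege1.
have Qsa : s * a <= Q.
  by rewrite QE -mulrA ler_peMr ?mulr_ege1//; lra.
have Qh : h^-1 <= 19 * Q.
  have -> : h^-1 = 19 * (t * eps^-1) by rewrite one_sub_gammaE; field; rewrite !gt_eqF//; lra.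
  have -> : Q = t * eps^-1 * (s * a * delta^-1) by rewrite QE; ring.
  have te0 : 0 <= t * eps^-1 by rewrite mulr_ge0//; lra.
  have : t * eps^-1 <= t * eps^-1 * (s * a * delta^-1) by rewrite ler_peMr// mulr_ege1.
  lra.
have hi0 : 0 <= h^-1 by rewrite invr_ge0 ltW.
have Y0 : 0 < Y by apply: lt_trans Y_ge1.
have YE : Y = (24 * 36 * (s ^+ 2 * a ^+ 3)) * log2 h^-1 * h^-1 ^+ 4 * t^-1 * delta^-1 ^+ 2.
  by rewrite /Y -/s -/a; field; rewrite !gt_eqF//; lra.
(* The tenth power collects [Q ^+ 3] from the cardinalities, [Q] from [log2], [Q ^+ 4] from [h] and
   [Q ^+ 2] from [delta]; moreover [24 * 36 * 2 * 19 ^+ 5 <= 10 ^+ 10]. *)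
have YQ : Y <= (10 * Q) ^+ 10.
  apply: (@le_trans _ _ ((24 * 36 * Q ^+ 3) * (2 * (19 * Q)) * (19 * Q) ^+ 4 * 1 * Q ^+ 2)); last first.
    have -> : (24 * 36 * Q ^+ 3) * (2 * (19 * Q)) * (19 * Q) ^+ 4 * 1 * Q ^+ 2 = 24 * 36 * 2 * 19 ^+ 5 * Q ^+ 10 by ring.
    by rewrite [leRHS]exprMn; apply: ler_wpM2r; [rewrite exprn_ge0//|]; lra.
  have Q0 : 0 <= Q by lra.
  have L0 : 0 <= log2 h^-1 by have := log2_ge1; lra.
  have ti : t^-1 <= 1 by rewrite invf_le1//; lra.
  have ti0 : 0 <= t^-1 by rewrite invr_ge0; lra.
  have di0 : 0 <= delta^-1 by lra.
  have s3 : s ^+ 2 * a ^+ 3 <= Q ^+ 3.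
    apply: (@le_trans _ _ ((s * a) ^+ 3)); last by rewrite lerXn2r ?nnegrE//; lra.
    rewrite exprMn; apply: ler_wpM2r; first by rewrite exprn_ge0//; lra.
    by rewrite [leRHS]exprS ler_peMl ?exprn_ge0//; lra.
  have p1 : 0 <= 24 * 36 * (s ^+ 2 * a ^+ 3).
    by apply: mulr_ge0; [lra|apply: mulr_ge0; apply: exprn_ge0; lra].
  have m1 : 24 * 36 * (s ^+ 2 * a ^+ 3) <= 24 * 36 * Q ^+ 3 by lra.
  have m2 : log2 h^-1 <= 2 * (19 * Q) by have := log2_le; lra.
  have m3 : h^-1 ^+ 4 <= (19 * Q) ^+ 4 by rewrite lerXn2r ?nnegrE//; lra.
  have m5 : delta^-1 ^+ 2 <= Q ^+ 2 by rewrite lerXn2r ?nnegrE//; lra.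
  have p3 : 0 <= h^-1 ^+ 4 by rewrite exprn_ge0.
  have p5 : 0 <= delta^-1 ^+ 2 by rewrite exprn_ge0.
  have p12 := mulr_ge0 p1 L0; have p123 := mulr_ge0 p12 p3.
  rewrite YE; apply: (ler_pM (mulr_ge0 p123 ti0) p5 _ m5).
  apply: (ler_pM p123 ti0 _ ti); apply: (ler_pM p12 p3 _ m3).
  exact: (ler_pM p1 L0 m1 m2).
have lQ : 0 <= ln Q by rewrite ln_ge0.
have lnY : ln Y <= 90 * (1 + ln Q).
  apply: (@le_trans _ _ (ln ((10 * Q) ^+ 10))); first by rewrite ler_ln ?posrE ?exprn_gt0//; lra.
  have Q0 : 0 < Q by lra.
  have -> : ln ((10 * Q) ^+ 10) = 10 * (ln 10 + ln Q).
    have p10 : 0 < 10 :> R by lra.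
    by rewrite (lnXn _ (mulr_gt0 p10 Q0)) (lnM p10 Q0) -[LHS]mulr_natl.
  have : ln 10 <= 9 :> R.
    have h9 : -1 < 9 :> R by lra.
    by have := le_ln1Dx h9; rewrite (_ : 1 + 9 = 10 :> R); [lra|ring].
  lra.
have nle : n%:R <= 10 ^+ 11 * (1 + ln Q) * (t / eps ^+ 2).
  apply: (le_trans n_of_le).
  (* This absorbs the [1] lost to the ceiling in [n]. *)
  have te1 : 1 <= t / eps ^+ 2.
    by rewrite ler_pdivlMr ?exprn_gt0// mul1r (le_trans _ t1)// exprn_ile1// ltW.
  have -> : c_const R * beta / (h ^+ 2 * t) = c_const R * 361 * beta * (t / eps ^+ 2).
    by rewrite one_sub_gammaE; field; rewrite !gt_eqF//; lra.
  apply: (@le_trans _ _ (c_const R * 361 * beta * (t / eps ^+ 2) + t / eps ^+ 2)); first by rewrite lerD2l.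
  rewrite -{2}[t / _]mul1r -mulrDl ler_wpM2r//; first lra.
  have /andP[_ c1] := c_const_bounds R.
  have := ler_wpM2r (ltW beta_of_gt0) c1; rewrite beta_ofE; lra.
rewrite !natrM -/s -/a.
have -> : 10 ^+ 11 * s * a * t / eps ^+ 2 * (1 + ln Q) = s * a * (10 ^+ 11 * (1 + ln Q) * (t / eps ^+ 2)).
  by field; rewrite gt_eqF.
by rewrite ler_wpM2l//; lra.
Qed.

End Calibration.

(** * Assembly of the high-probability guarantee *)

Section Main.
Variables (R : realType) (S A : finType) (r : S -> A -> R) (p : S -> A -> S -> R).
Variables (mu : S -> R) (eps delta : R) (s0 : S) (a0 : A).
Hypotheses (rP : forall s a, 0 <= r s a <= 1) (pP : forall s a, is_prob (p s a)).
Hypotheses (muP : is_prob mu) (erg : uniformly_ergodic p).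
Hypotheses (epsP : 0 < eps <= 1) (deltaP : 0 < delta < 1).

Let t := tminorize p.
Let g := gamma_of eps t.
Let zeta := zeta_of g t.
Let n := n_of #|S| #|A| eps delta t.
Let beta := beta_of #|S| #|A| g delta (eta_star #|S| #|A| zeta delta g).

(* [tau] is the mesh of the net of frozen values, [J] its size, and [lam] the Chernoff
   parameter; [4 * lam] is the variance coefficient of [deviation_potential]. *)
Let tau : R := (1 - g) * t / 10.
Let lam : R := (1 - g) / 160.
Let J := (Num.truncn (2 / (1 - g) / tau)).+1.

Let S0 : (0 < #|S|)%N. Proof. by apply/card_gt0P; exists s0. Qed.
Let A0 : (0 < #|A|)%N. Proof. by apply/card_gt0P; exists a0. Qed.
Let t1 : 1 <= t. Proof. exact: tminorize_ge1. Qed.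
Let h_gt0 : 0 < 1 - g. Proof. by case/andP: (one_sub_gamma_bounds epsP t1). Qed.
Let h_le : 1 - g <= 1 / 19. Proof. by case/andP: (one_sub_gamma_bounds epsP t1). Qed.
Let h_tE : (1 - g) * t = eps / 19. Proof. exact: one_sub_gamma_mul. Qed.
Let n0 : (0 < n)%N. Proof. exact: n_of_gt0. Qed.

Let tau0 : 0 < tau.
Proof. by have /andP[e0 _] := epsP; rewrite /tau h_tE; lra. Qed.

Let zeta0 : 0 < zeta.
Proof. by have /andP[e0 _] := epsP; rewrite /zeta zeta_ofE//; lra. Qed.

Let g01 : 0 <= g < 1.
Proof. by have h0 := h_gt0; have h1 := h_le; apply/andP; split; lra. Qed.

Let reward_bounds (z : S -> A -> R) : (forall s a, 0 <= z s a <= zeta) -> forall s a, 0 <= r s a + z s a <= 2.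
Proof.
move=> zP s a; have /andP[r0 r1] := rP s a; have /andP[z0 z1] := zP s a.
have /andP[e0 e1] := epsP; have zE : zeta = eps / 76 by exact: zeta_ofE.
by apply/andP; split; lra.
Qed.

Let C0 : 0 <= 2 / (1 - g).
Proof. by rewrite divr_ge0// ltW. Qed.

Let J_gt : 2 / (1 - g) < J%:R * tau.
Proof. by rewrite -ltr_pdivrMr// truncnS_gt. Qed.

Let J_le : J.-1%:R * tau <= 2 / (1 - g).
Proof. by rewrite -ler_pdivlMr// truncn_le// divr_ge0// ltW. Qed.

Let J_bound : 0 <= (J%:R : R) <= 21 / (1 - g) ^+ 2.
Proof.
have /andP[e0 e1] := epsP.
rewrite ler0n /= /J -natr1; apply: (@le_trans _ _ (2 / (1 - g) / tau + 1)).
  by rewrite lerD2r truncn_le// divr_ge0// ltW.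
have -> : 2 / (1 - g) / tau = 20 / (1 - g) ^+ 2 / t.
  by rewrite /tau; field; have t1' := t1; rewrite !gt_eqF//; lra.
have H : 1 <= ((1 - g) ^+ 2)^-1.
  rewrite invf_ge1 ?exprn_gt0// exprn_ile1 ?(ltW h_gt0)//.
  by have := h_le; lra.
have : 20 / (1 - g) ^+ 2 / t <= 20 / (1 - g) ^+ 2.
  by rewrite ler_pdivrMr ?(lt_le_trans _ t1)// ler_peMr// divr_ge0 ?exprn_ge0 ?(ltW h_gt0).
lra.
Qed.

Let iterations : exists K, g ^+ K * (2 / (1 - g)) <= tau.
Proof.
have /andP[g0 g1] := g01.
have : (fun K => g ^+ K * (2 / (1 - g))) @ \oo --> 0 * (2 / (1 - g)).
  by apply: cvgMr_tmp; apply: cvg_expr; rewrite ger0_norm.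
rewrite mul0r => /cvgr0Pnorm_le /(_ _ tau0) [K _ /(_ K (leqnn K))] /= H.
by exists K; apply: le_trans (ler_norm _) H.
Qed.

Section Gap.
Variables (K : nat) (zr z : S -> A -> R) (x : {ffun S * A * 'I_n -> S}) (pi : policy S A).
Hypothesis KP : g ^+ K * (2 / (1 - g)) <= tau.
Hypotheses (zP : forall s a, 0 <= z s a <= zeta).
Hypothesis zrz : forall s a, `|zr s a - z s a| <= (1 - g) * tau.
Hypothesis good : ~~ bad p (fun s a => r s a + zr s a) g tau lam beta J K x.
Hypothesis out : pmbp_output (fun s a => r s a + z s a) g (phat R n (samp x)) pi.

Lemma good_gap pi0 : avg_reward r p mu pi0 - avg_reward r p mu pi <= eps.
Proof.
have [v [bell greedy]] := out.
have phP s a := phat_is_prob R n0 (samp x) s a.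
have g19 : 18 / 19 <= g < 1 by have h0 := h_gt0; have h1 := h_le; apply/andP; split; lra.
have RwP := reward_bounds zP.
have vP s : 0 <= v s <= 2 / (1 - g).
  have [v0 v1] := bellman_bounds phP g19 RwP bell s.
  by rewrite v0 ler_pdivlMr// mulrC.
have lam0 : 0 < lam by have := h_gt0; rewrite /lam; lra.
have zrz' s a : `|r s a + zr s a - (r s a + z s a)| <= (1 - g) * tau.
  by rewrite opprD addrACA subrr add0r.
pose b := beta / (n%:R * lam) + 2 * (3 * tau) + 4 * lam * (3 * tau) ^+ 2.
have dev s a : `|ev (phat R n (samp x) s a) v - ev (p s a) v| <= (1 - g) / 40 * var (p s a) v + b.
  have -> : (1 - g) / 40 = 4 * lam by rewrite /lam; lra.
  by apply: good_fixpoint_deviation bell KP zrz' J_gt _ _ good.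
have beta0 : 0 < beta by exact: beta_of_gt0.
have nR : 0 < n%:R :> R by rewrite ltr0n.
(* The three summands of [b] take at most [1 / 10], [6 / 10] and [1 / 10] of [(1 - g) * t]. *)
have b1 : beta / (n%:R * lam) <= (1 - g) * t / 10.
  have c5 : 10 ^+ 5 * beta <= n%:R * ((1 - g) ^+ 2 * t).
    apply: (@le_trans _ _ (c_const R * beta)).
      by case/andP: (c_const_bounds R) => c5 _; rewrite ler_wpM2r// ltW.
    rewrite -ler_pdivrMr; first exact: n_of_ge.
    by rewrite mulr_gt0 ?exprn_gt0// (lt_le_trans _ t1).
  rewrite ler_pdivrMr ?mulr_gt0//.
  have -> : (1 - g) * t / 10 * (n%:R * lam) = n%:R * ((1 - g) ^+ 2 * t) / 1600.
    by rewrite /lam; field.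
  by move: beta0 c5; move: beta (n%:R * _) => B NN; lra.
have e3 : 0 <= 4 * lam * (3 * tau) ^+ 2 <= (1 - g) * t / 10.
  have tauE : tau = eps / 190 by rewrite /tau h_tE; lra.
  have /andP[e0 e1] := epsP; rewrite h_tE tauE /lam.
  have : 0 <= (1 - g) * eps ^+ 2 by rewrite mulr_ge0 ?exprn_ge0 ?(ltW h_gt0) ?(ltW e0).
  have : (1 - g) * eps ^+ 2 <= 1 * eps.
    by rewrite expr2 mulrA ler_wpM2r ?(ltW e0)// mulr_ile1 ?(ltW h_gt0) ?(ltW e0)//; have := h_le; lra.
  by move=> ? ?; apply/andP; split; lra.
have tau1 : 0 < tau := tau0.
have /andP[e30 e31] := e3.
have b0 : 0 <= b.
  rewrite /b; have : 0 <= beta / (n%:R * lam) by apply: ltW; apply: divr_gt0 => //; exact: mulr_gt0.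
  lra.
have bt : b <= (1 - g) * tminorize p.
  have tauE : 2 * (3 * tau) = 6 / 10 * ((1 - g) * t) by rewrite /tau; field.
  have ht0 : 0 < (1 - g) * t by rewrite mulr_gt0// (lt_le_trans _ t1).
  rewrite -/t /b; move: b1 e31 tauE ht0; move: ((1 - g) * t) (beta / _) (2 * _) (4 * _ * _).
  by move=> y1 y2 y3 y4; lra.
have [m [q [psi minm]]] := erg pi; have [m' [q' [psi' minm']]] := erg pi0.
have [rho [rhoP st ->]] := stationary_avg_reward pP minm s0 muP.
have [rho0 [rho0P st0 ->]] := stationary_avg_reward pP minm' s0 muP.
have gap := planning_gap pP phP erg g19 RwP bell greedy b0 dev s0 bt rho0P st0 rhoP st.
have up : ev rho0 (fun s => r s (pi0 s)) <= ev rho0 (fun s => r s (pi0 s) + z s (pi0 s)).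
  by apply: le_ev => // s; case/andP: (zP s (pi0 s)); rewrite lerDl.
have lo : ev rho (fun s => r s (pi s) + z s (pi s)) <= ev rho (fun s => r s (pi s)) + zeta.
  rewrite -[X in _ + X](ev_cst _ rhoP) -evD; apply: le_ev => // s.
  by case/andP: (zP s (pi s)); rewrite lerD2l.
have /andP[e0 e1] := epsP.
have zE : zeta = eps / 76 by exact: zeta_ofE.
(* The planning gap and the noise together cost [12 / 19 + 1 / 76 < 1] times [eps]. *)
by move: gap; rewrite -/t h_tE; lra.
Qed.

End Gap.

Variables (d : measure_display) (Omega : measurableType d) (P : probability Omega R).
Variables (Z : Omega -> S -> A -> R) (X : Omega -> S -> A -> nat -> S).
Hypothesis law : forall (lo hi : S -> A -> R) (x : S -> A -> nat -> S),
  let E := [set w | (forall s a, lo s a <= Z w s a <= hi s a) /\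
                    (forall s a i, (i < n)%N -> X w s a i = x s a i)] in
  measurable E /\
  P E = ((\prod_(s : S) \prod_(a : A) (overlap zeta (lo s a) (hi s a) / zeta))
         * \prod_(s : S) \prod_(a : A) \prod_(i < n) p s a (x s a i))%:E.

Lemma pmbp_whp : exists E : set Omega,
  measurable E /\ ((1 - delta)%:E <= P E)%E /\
  forall w, E w -> forall pi,
    pmbp_output (fun s a => r s a + Z w s a) g (phat R n (X w)) pi ->
    0 <= opt_avg_reward r p mu - avg_reward r p mu pi <= eps.
Proof.
have [K KP] := iterations.
have /andP[g0 g1] := g01.
(* The cells are fine enough for the noise error, amplified by [(1 - g)^-1], to stay below [tau]. *)
pose N := (Num.truncn (zeta / ((1 - g) * tau))).+1.
have NP : zeta / N%:R <= (1 - g) * tau.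
  have ht0 : 0 < (1 - g) * tau by rewrite mulr_gt0.
  by rewrite ler_pdivrMr ?ltr0n// mulrC -ler_pdivrMr// ltW// truncnS_gt.
pose bd (k : {ffun S * A -> 'I_N}) (x : {ffun S * A * 'I_n -> S}) :=
  bad p (fun s a => r s a + grid zeta k s a) g tau lam beta J K x.
have bdP k : \sum_(x | bd k x) weight (fun sai => p sai.1.1 sai.1.2) x <= delta.
  apply: (le_trans (sum_bad _ n0 _ _ g01 _ _ _ _ _)) => //.
  - exact: reward_bounds (grid_bounds zeta0 _ _).
  - by rewrite /lam divr_gt0.
  - by rewrite /lam; have -> : (1 - g) / 160 * (2 / (1 - g)) = 1 / 80; [field; rewrite gt_eqF|lra].
  - exact: union_bound_le_delta.
have [F [mF PF FP]] := good_event pP zeta0 law (ltn0Sn _ : (0 < N)%N) bdP.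
exists F; split=> //; split=> // w /FP[k [x [ZP Zk Xx good]]] pi out.
have opt_ge : avg_reward r p mu pi <= opt_avg_reward r p mu.
  exact: (le_bigmax _ (fun pi => avg_reward r p mu pi) pi).
rewrite subr_ge0 opt_ge lerBlDr /=.
have gap pi0 : avg_reward r p mu pi0 <= eps + avg_reward r p mu pi.
  rewrite -lerBlDr; apply: (good_gap KP ZP _ good).
    move=> s a; have /andP[z1 z2] := Zk s a.
    by rewrite distrC ger0_norm ?subr_ge0//; lra.
  suff -> : phat R n (samp x) = phat R n (X w) by [].
  apply/funext => s; apply/funext => a; apply/funext => s'; rewrite /phat.
  by congr (_ * _); apply: eq_bigr => i _; rewrite Xx.
(* The remaining case is the default [0] of the maximum, covered by the nonnegativity of the
   rewards. *)
apply: bigmax_le => [|pi0 _]; last exact: gap.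
have [m [q [psi minm]]] := erg pi.
have [rho [rhoP _ ->]] := stationary_avg_reward pP minm s0 muP.
have : 0 <= ev rho (fun s => r s (pi s)) by apply: ev_ge => // s; case/andP: (rP s (pi s)).
by have /andP[e0 _] := epsP; lra.
Qed.

End Main.

Theorem theorem2 :
  exists C k : nat,
  forall (R : realType) (S A : finType)
    (r : S -> A -> R) (p : S -> A -> S -> R) (mu : S -> R)
    (eps delta : R)
    (d : measure_display) (Omega : measurableType d)
    (P : probability Omega R)
    (Z : Omega -> S -> A -> R) (X : Omega -> S -> A -> nat -> S),
  (0 < #|S|)%N -> (0 < #|A|)%N ->
  (forall s a, 0 <= r s a <= 1) ->
  (forall s a, is_prob (p s a)) ->
  is_prob mu ->
  uniformly_ergodic p ->
  0 < eps <= 1 -> 0 < delta < 1 ->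
  let t := tminorize p in
  let gamma := gamma_of eps t in
  let zeta := zeta_of gamma t in
  let n := n_of #|S| #|A| eps delta t in
  (* joint law: Z(s,a) i.i.d. Unif(0,zeta), independent of the samples
     X(s,a,i) ~ p(s,a), i < n, all independent *)
  (forall (lo hi : S -> A -> R) (x : S -> A -> nat -> S),
     let E := [set w | (forall s a, lo s a <= Z w s a <= hi s a) /\
                       (forall s a i, (i < n)%N -> X w s a i = x s a i)] in
     measurable E /\
     P E = ((\prod_(s : S) \prod_(a : A) (overlap zeta (lo s a) (hi s a) / zeta))
            * \prod_(s : S) \prod_(a : A) \prod_(i < n) p s a (x s a i))%:E) ->
  (exists E : set Omega,
     measurable E /\ ((1 - delta)%:E <= P E)%E /\
     forall w, E w ->
       forall pi : {ffun S -> A},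
         pmbp_output (fun s a => r s a + Z w s a) gamma (phat R n (X w)) pi ->
         0 <= opt_avg_reward r p mu - avg_reward r p mu pi <= eps)
  /\
  (#|S| * #|A| * n)%:R <=
    C%:R * #|S|%:R * #|A|%:R * t / eps ^+ 2 *
    (1 + ln (#|S|%:R * #|A|%:R * t / (eps * delta))) ^+ k.
Proof.
(* One power of the logarithm is enough because [n] is linear in [beta], up to rounding. *)
exists (10 ^ 11)%N, 1%N => R S A r p mu eps delta d Omega P Z X S0 A0 rP pP muP erg epsP deltaP t gamma zeta n law.
have /card_gt0P[s0 _] := S0; have /card_gt0P[a0 _] := A0.
split; first exact: pmbp_whp.
rewrite expr1 natrX; apply: sample_complexity => //.
exact: tminorize_ge1.
Qed.
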